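(* For $n>0$ let $I(n)=\int_0^1[x^n+(1-x)^n]^{1/n}\,dx$. As $n\to\infty$, $I(n)$ has an asymptotic series $I(n)\sim\sum_{j=0}^\infty \frac{I_j}{n^j}$, and for every integer $p\ge 2$ its coefficient $I_p$ is given by \[ I_p=(-1)^p\sum_{j=2}^p a_{\lfloor\frac{j-1}{2}\rfloor}\,\zeta(\bar j,\{1\}_{p-j}), \] where, for integers $n\ge 0$, \[ a_n=\tfrac12E_{2n+1}(0)=\frac{(1-2^{2n+2})B_{2n+2}}{2n+2}. \]
   Context: The asymptotic series means that for every $N\ge 0$, $I(n)=\sum_{j=0}^N I_j n^{-j}+O(n^{-N-1})$ as $n\to\infty$; the coefficients $I_j$ are uniquely determined by this. $\{1\}_m$ denotes $1$ repeated $m$ times. The alternating multiple zeta value is $\zeta(\bar j,\{1\}_{m})=\sum_{n_1>n_2>\cdots>n_{m+1}\ge 1}\frac{(-1)^{n_1}}{n_1^{j}\,n_2\cdots n_{m+1}}$ (so $\zeta(\bar j)=\sum_{n\ge1}(-1)^n/n^j$ when $m=0$). $E_n(x)$ are the Euler polynomials, $\frac{2e^{tx}}{1+e^t}=\sum_{j\ge0}E_j(x)\frac{t^j}{j!}$, and $B_n$ are the Bernoulli numbers. *)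

(* Defs.v *)
From HB Require Import structures.
From mathcomp Require Import all_boot all_order all_algebra.
From mathcomp Require Import all_classical all_reals all_analysis.

Set Implicit Arguments.
Unset Strict Implicit.
Unset Printing Implicit Defensive.

Import Order.TTheory GRing.Theory Num.Theory.
Import numFieldNormedType.Exports.

Local Open Scope classical_set_scope.
Local Open Scope ring_scope.

Definition I_int (R : realType) (n : R) : R :=
  \int[lebesgue_measure]_(x in `[0, 1]) ((x `^ n + (1 - x) `^ n) `^ n^-1).

(* The argument [n] is a real number tending to infinity. *)
Definition asymptotic_series (R : realType) (f : R -> R) (c : nat -> R) : Prop :=
  forall N : nat, exists C : R,
    \forall n \near +oo,
      `|f n - \sum_(j < N.+1) c j * n ^- j| <= C * n ^- N.+1.

(* The part of zeta(bar j, {1}_m) with n_1 <= N.  The tuple [t] carries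
   n_i = t_i + 1 for i = 1, ..., m + 1. *)
Definition alt_mzv_partial (R : realType) (j m N : nat) : R :=
  \sum_(t : m.+1.-tuple 'I_N |
        [forall a : 'I_m.+1, forall b : 'I_m.+1,
           (a < b)%N ==> (tnth t b < tnth t a)%N])
    (-1) ^+ (tnth t ord0).+1 / (tnth t ord0).+1%:R ^+ j
      * \prod_(i < m) ((tnth t (lift ord0 i)).+1%:R)^-1.

(* zeta(bar j, {1}_m), summed in increasing order of the largest index n_1;
   the multiple series converges absolutely for j >= 2. *)
Definition alt_mzv (R : realType) (j m : nat) : R :=
  limn (@alt_mzv_partial R j m).

(* E_n(x), read off from the exponential generating function
   2 e^(tx) / (1 + e^t) as its n-th derivative in t at t = 0. *)
Definition euler_poly (R : realType) (n : nat) (x : R) : R :=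
  derive1n n (fun t : R => 2 * expR (t * x) / (1 + expR t)) 0.

(* The list B_0, ..., B_(n-1). *)
Fixpoint bernoulli_seq (R : realType) (n : nat) : seq R :=
  if n is m.+1 then
    let s := bernoulli_seq R m in
    rcons s (((m == 0)%:R - \sum_(k < m) 'C(m.+1, k)%:R * s`_k) / m.+1%:R)
  else [::].

Definition bernoulli_number (R : realType) (n : nat) : R :=
  (bernoulli_seq R n.+1)`_n.

Lemma size_bernoulli_seq (R : realType) (n : nat) :
  size (bernoulli_seq R n) = n.
Proof. by elim: n => //= n IHn; rewrite size_rcons IHn. Qed.

Lemma nth_bernoulli_seq (R : realType) (n k : nat) :
  (k < n)%N -> (bernoulli_seq R n)`_k = bernoulli_number R k.
Proof.
elim: n => // n IHn; rewrite ltnS leq_eqVlt => /predU1P[->//|kn].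
by rewrite /= nth_rcons size_bernoulli_seq kn IHn.
Qed.

Lemma bernoulli_number_rec (R : realType) (n : nat) :
  \sum_(k < n.+1) 'C(n.+1, k)%:R * bernoulli_number R k = (n == 0)%:R.
Proof.
rewrite big_ord_recr /= binSn.
rewrite {2}/bernoulli_number /= nth_rcons size_bernoulli_seq ltnn eqxx.
rewrite mulrC divfK ?pnatr_eq0//.
under [X in _ - X]eq_bigr => k _ do rewrite nth_bernoulli_seq//.
by rewrite addrC subrK.
Qed.

Definition a_coef (R : realType) (n : nat) : R :=
  2^-1 * euler_poly (2 * n).+1 (0 : R).

(* Main.v *)
Require Import Defs.
From mathcomp Require Import all_boot all_order all_algebra.
From mathcomp Require Import all_classical all_reals all_analysis.
From mathcomp Require Import measurable_realfun ring lra.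
Import Order.TTheory GRing.Theory Num.Theory.
Import numFieldNormedType.Exports.
Local Open Scope classical_set_scope.
Local Open Scope ring_scope.

(** Write h = 1/n, sigma(t) = 1 / (1 + e^-t), l(s) = ln (1 + e^-s) and
g = sigma sigma'. As s runs over the half-line, sigma (h s) runs over
[1/2, 1), where the integrand of I(n) becomes sigma (h s) e^(h l(s)); with the
symmetry between x and 1 - x this gives [I_int_halfline]:
  I(n) = 2 h int_0^oo g(h s) e^(h l(s)) ds.
Replacing the exponential by 1 contributes int_0^oo 2 g = 3/4, and
  I(n) = 3/4 + 2 h int_0^oo g(h s) (e^(h l(s)) - 1) ds          ([I_intE]).
Since l(s) <= e^-s, the last integrand and all its derivatives in h decay
exponentially in s, uniformly for h in [0, 1]. Its Taylor formula at h = 0 can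
therefore be integrated term by term ([residual_integral_expansion]), which
proves that the series exists and gives, for k >= 0,
  I_(k+1) = 2 sum_(i<k) g^(i)(0) / i! int_0^oo s^i l(s)^(k-i) / (k-i)! ds.

The moments are alternating multiple zeta values ([alt_mzvE]). Indeed
  ln (1 + y)^m / m! = (-1)^m sum_(n_1 > ... > n_m) (-y)^n_1 / (n_1 ... n_m),
and with y = e^-s the monomials are integrated by
int_0^oo s^k e^(-n s) ds = k! / n^(k+1). Sum and integral may be exchanged
because on [0, 1] the N-th partial sum is within y eps_N of the function, where
eps_N tends to 0 ([ln1p_power_polyP], [cvg_ln1p_power_err]).

The numbers g^(i)(0) come from sigma' = sigma - sigma^2, which turns g into
(sigma' - sigma'') / 2. The function sigma - 1/2 is odd, hence only one of the
two terms of g^(i) survives at 0, according to the parity of i, and it is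
a_(floor ((i+1)/2)) / 2 up to sign because 2 / (1 + e^t) = 2 - 2 sigma(t)
([sigmoid_weight_at0]).

For the Bernoulli form of a_n, differentiating (1 + e^t) (2 / (1 + e^t)) = 2
gives a recurrence that determines the E_n(0), and
2 (1 - 2^(n+1)) B_(n+1) / (n+1) satisfies it by the duplication formula
sum_k C(n,k) 2^k B_k = (2 - 2^n) B_n ([bernoulli_duplication]). *)

Local Notation mu := (@lebesgue_measure _).

(** * Chains of successive derivatives *)

(** Listing the successive derivatives as explicit functions makes Leibniz' rule
and Taylor's formula available without any differentiability hypothesis. *)
Definition derivative_chain (R : realType) (f : nat -> R -> R) : Prop :=
  forall (n : nat) (x : R), is_derive x 1 (f n) (f n.+1 x).

Lemma derive1n_chain (R : realType) (f : nat -> R -> R) (n : nat) :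
  derivative_chain R f -> derive1n n (f 0%N) = f n.
Proof.
move=> df; elim: n => [|n IHn]; first by rewrite derive1n0.
by rewrite derive1nS IHn; apply/funext => x; rewrite derive1E; case: (df n x).
Qed.

(** Pascal's rule, in the form in which it yields Leibniz' rule. *)
Lemma binomial_convolutionS (R : realType) (n : nat) (a b : nat -> R) :
  \sum_(i < n.+2) 'C(n.+1, i)%:R * (a i * b (n.+1 - i)%N) =
  \sum_(i < n.+1) 'C(n, i)%:R * (a i.+1 * b (n - i)%N + a i * b (n - i).+1).
Proof.
under [RHS]eq_bigr do rewrite mulrDr.
rewrite big_split /= [X in _ = _ + X]big_ord_recl /= bin0 !subn0.
rewrite big_ord_recl /= bin0 subn0 addrCA; congr (_ + _).
under eq_bigr => i _.
  rewrite /bump /= add1n binS natrD mulrDl subSS; over.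
rewrite big_split /= addrC; congr (_ + _).
rewrite big_ord_recr /= bin_small// mul0r addr0.
apply: eq_bigr => i _; rewrite /bump /= add1n.
by congr (_ * (_ * b _)); rewrite subnSK.
Qed.

Lemma leibniz_chain (R : realType) (u v : nat -> R -> R) :
  derivative_chain R u -> derivative_chain R v ->
  derivative_chain R
    (fun n x => \sum_(i < n.+1) 'C(n, i)%:R * (u i x * v (n - i)%N x)).
Proof.
move=> du dv n x.
have -> : (fun x => \sum_(i < n.+1) 'C(n, i)%:R * (u i x * v (n - i)%N x)) =
    \sum_(i < n.+1) ('C(n, i)%:R \*: (u i \* v (n - i)%N)).
  by apply/funext => y; rewrite fct_sumE.
rewrite (binomial_convolutionS R n (u ^~ x) (v ^~ x)).
apply: is_derive_sum => i; apply: is_deriveZ.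
apply: (is_derive_eq (is_deriveM (du i x) (dv (n - i)%N x))).
by rewrite /GRing.scale /= addrC mulrC [X in _ + X]mulrC [X in _ + X]mulrC mulrC.
Qed.

(** Without the factor 1/n! the bound is a plain induction: the remainder
vanishes at 0, its derivative is the remainder of the shifted chain, and the
mean value theorem costs one factor x. *)
Lemma taylor_chain (R : realType) (n : nat) (f : nat -> R -> R) (C x : R) :
  derivative_chain R f -> 0 <= x ->
  (forall t : R, 0 <= t <= x -> `|f n t| <= C) ->
  `|f 0%N x - \sum_(k < n) f k 0 / k`!%:R * x ^+ k| <= C * x ^+ n.
Proof.
elim: n f C x => [|n IHn] f C x df x0 fC.
  by rewrite big_ord0 subr0 mulr1 fC// x0 lexx.
pose r t := f 0%N t - \sum_(k < n.+1) f k 0 / k`!%:R * t ^+ k.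
pose r' t := f 1%N t - \sum_(k < n) f k.+1 0 / k`!%:R * t ^+ k.
have C0 : 0 <= C by apply: le_trans (fC 0 _); rewrite ?lexx.
have dr (t : R) : is_derive t 1 r (r' t).
  have -> : r = f 0%N - \sum_(k < n.+1)
      ((f k 0 / k`!%:R) \*: ((id : R -> R) ^+ k)).
    apply/funext => y; rewrite /r fctE fct_sumE; congr (_ - _).
    by apply: eq_bigr => i _; rewrite fctE.
  have := is_deriveB (df 0%N t) (is_derive_sum (fun k : 'I_n.+1 =>
    is_deriveZ (f k 0 / k`!%:R) (is_deriveX k (is_derive_id t (1 : R))))).
  move=> /is_derive_eq; apply.
  rewrite /r' big_ord_recl /= mul0r scale0r scaler0 add0r; congr (_ - _).
  apply: eq_bigr => i _; rewrite /bump /= add1n.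
  rewrite /GRing.scale /= mulr1 factS natrM.
  by field; rewrite addrC natr1 !pnatr_eq0 -lt0n fact_gt0.
have r0 : r 0 = 0.
  rewrite /r big_ord_recl /= fact0 divr1 expr0 mulr1 big1 ?addr0 ?subrr//.
  by move=> i _; rewrite expr0n mulr0.
have [] := @MVT_segment _ r r' 0 x x0 (fun t _ => dr t).
  apply: derivable_within_continuous => t _; exact: (@ex_derive _ _ _ _ _ _ _ (dr t)).
move=> z /itvP zx; rewrite r0 !subr0 => rx; rewrite -[X in `|X|]/(r x) rx.
rewrite normrM (ger0_norm x0) exprSr mulrA ler_wpM2r//.
apply: (le_trans (IHn (fun k => f k.+1) C z (fun k => df k.+1) _ _)).
- by rewrite zx.
- by move=> t /andP[t0 tz]; apply: fC; rewrite t0 (le_trans tz)// zx.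
- by rewrite ler_wpM2l// lerXn2r ?nnegrE ?zx.
Qed.

(** The mean value theorem for b - f and b + f, which are nondecreasing. *)
Lemma derivative_domination (R : realType) (f f' b b' : R -> R) (x : R) :
  0 <= x ->
  (forall t, 0 <= t <= x ->
     [/\ is_derive t 1 f (f' t), is_derive t 1 b (b' t) & `|f' t| <= b' t]) ->
  `|f x - f 0| <= b x - b 0.
Proof.
move=> x0 H.
have mono (g g' : R -> R) : (forall t, 0 <= t <= x ->
    is_derive t 1 g (g' t) /\ 0 <= g' t) -> g 0 <= g x.
  move=> Hg; have [t tx||c cx gE] := @MVT_segment _ g g' 0 x x0.
  - by move: tx; rewrite in_itv /= => /andP[t0 tx]; have [|//] := Hg t; rewrite !ltW.
  - apply: derivable_within_continuous => y; rewrite in_itv /= => yx.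
    by have [dy _] := Hg y yx; exact: (@ex_derive _ _ _ _ _ _ _ dy).
  rewrite -subr_ge0 gE subr0 mulr_ge0//.
  by move: cx; rewrite in_itv /= => /Hg[].
rewrite ler_norml; apply/andP; split.
  have := mono (b + f) (fun t => b' t + f' t) _.
  rewrite !fctE lerNl opprB => H1; rewrite -subr_ge0.
  suff : b 0 + f 0 <= b x + f x by lra.
  apply: H1 => t /H[df db fb]; split; first exact: is_deriveD.
  by move: fb; rewrite ler_norml => /andP[]; lra.
have := mono (b - f) (fun t => b' t - f' t) _.
rewrite !fctE => H1.
suff : b 0 - f 0 <= b x - f x by lra.
apply: H1 => t /H[df db fb]; split; first exact: is_deriveB.
by move: fb; rewrite ler_norml => /andP[]; lra.
Qed.

Lemma is_derive_continuous (R : realType) (f f' : R -> R) :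
  (forall x : R, is_derive x 1 f (f' x)) -> continuous f.
Proof.
move=> df x; apply: differentiable_continuous; apply/derivable1_diffP.
exact: (@ex_derive _ _ _ _ _ _ _ (df x)).
Qed.

(** * Bernoulli numbers and the Euler recurrence *)

(** The sums form a triangular linear system in the values of u, with diagonal
entries C(n+1, n) = n + 1. *)
Lemma binomial_sums_inj (R : realType) (u v : nat -> R) :
  (forall n, \sum_(k < n.+1) 'C(n.+1, k)%:R * u k =
             \sum_(k < n.+1) 'C(n.+1, k)%:R * v k) -> u =1 v.
Proof.
move=> uv n; elim/ltn_ind: n => n IHn.
have := uv n; rewrite !big_ord_recr /= (eq_bigr (fun k : 'I_n => 'C(n.+1, k)%:R * v k)).
  by move/addrI/mulfI; apply; rewrite pnatr_eq0 binSn.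
by move=> k _; rewrite IHn.
Qed.

(** This is 2^n B_n(1/2) = (2 - 2^n) B_n. Let phi be the linear functional on
polynomials that sends X^k to B_k; the recurrence of the Bernoulli numbers says
that phi sends p(X + 1) - p(X) to p'(0). The functional that sends p to
phi (p(2X + 1) + p(2X)) takes the value 2 p'(0) on such a difference, and every
polynomial is one, so this functional is 2 phi. *)
Lemma bernoulli_duplication (R : realType) (n : nat) :
  \sum_(k < n.+1) 'C(n, k)%:R * (2 ^+ k * bernoulli_number R k) =
  (2 - 2 ^+ n) * bernoulli_number R n.
Proof.
pose phi (p : {poly R}) := \sum_(i < size p) p`_i * bernoulli_number R i.
have phiE m (p : {poly R}) : (size p <= m)%N ->
    phi p = \sum_(i < m) p`_i * bernoulli_number R i.
  move=> pm; rewrite /phi (big_ord_widen m (fun i => p`_i * bernoulli_number R i) pm).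
  rewrite big_mkcond; apply: eq_bigr => i _; case: ifPn => //.
  by rewrite -leqNgt => /(nth_default 0) ->; rewrite mul0r.
have phiD p q : phi (p + q) = phi p + phi q.
  rewrite !(@phiE (maxn (size p) (size q))) ?leq_maxl ?leq_maxr ?size_polyD//.
  by rewrite -big_split /=; apply: eq_bigr => i _; rewrite coefD mulrDl.
have phiZ a p : phi (a *: p) = a * phi p.
  rewrite !(@phiE (size p)) ?size_scale_leq// mulr_sumr.
  by apply: eq_bigr => i _; rewrite coefZ mulrA.
have phi0 : phi 0 = 0 by rewrite /phi size_poly0 big_ord0.
have phiXn k : phi 'X^k = bernoulli_number R k.
  rewrite (@phiE k.+1) ?size_polyXn// big_ord_recr /= coefXn eqxx mul1r big1 ?add0r//.
  by move=> i _; rewrite coefXn (ltn_eqF (ltn_ord i)) mul0r.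
have phi_sum m (F : 'I_m -> {poly R}) : phi (\sum_(i < m) F i) = \sum_(i < m) phi (F i).
  by apply: (big_morph phi phiD phi0).

have diffE (x : {poly R}) m :
    \sum_(k < m.+1) 'C(m.+1, k)%:R *: x ^+ k = (x + 1) ^+ m.+1 - x ^+ m.+1.
  rewrite [x + 1]addrC exprDn [in RHS]big_ord_recr /= subnn expr0 mul1r binn mulr1n addrK.
  by apply: eq_bigr => i _; rewrite expr1n mul1r scaler_nat.
have phi_diff m : phi (('X + 1) ^+ m.+1 - 'X^(m.+1)) = (m == 0%N)%:R.
  rewrite -bernoulli_number_rec -diffE phi_sum.
  by apply: eq_bigr => i _; rewrite phiZ phiXn.
pose y : {poly R} := 2 *: 'X.
have yX k : y ^+ k = 2 ^+ k *: 'X^k by rewrite /y exprZn.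
suff H : (fun k => phi ((y + 1) ^+ k + y ^+ k)) =1
    (fun k => 2 * bernoulli_number R k).
  rewrite mulrBl -(H n) phiD yX phiZ phiXn addrK addrC exprDn phi_sum.
  apply: eq_bigr => i _.
  by rewrite expr1n mul1r yX -[X in phi X]scaler_nat !phiZ phiXn.
apply: binomial_sums_inj => m.
(* The differences of X^(m+1) from 2X to 2X + 1 and from 2X + 1 to 2X + 2 add
up to its difference from 2X to 2X + 2. *)
transitivity (phi ((y + 1 + 1) ^+ m.+1 - y ^+ m.+1)).
  rewrite -(subrK ((y + 1) ^+ m.+1) ((y + 1 + 1) ^+ m.+1)) -addrA -!diffE -big_split phi_sum.
  by apply: eq_bigr => i _; rewrite /= -scalerDr phiZ.
have -> : y + 1 + 1 = 2 *: ('X + 1).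
  by rewrite scalerDr -addrA -/y; congr (_ + _); rewrite -mulr2n -scaler_nat.
rewrite exprZn yX -scalerBr phiZ phi_diff -bernoulli_number_rec mulr_sumr.
case: m => [|m]; first by rewrite !big_ord_recl !big_ord0 /= expr1; ring.
transitivity (0 : R).
  by rewrite -mulr_sumr bernoulli_number_rec mulr0.
under [RHS]eq_bigr do rewrite mulrCA.
by rewrite -mulr_sumr bernoulli_number_rec mulr0.
Qed.

(** The recurrence determines e n from its predecessors, and
[bernoulli_duplication] shows that the Bernoulli expression satisfies it. *)
Lemma euler_number_unique (R : realType) (e : nat -> R) :
  (forall n, e n + \sum_(k < n.+1) 'C(n, k)%:R * e k = 2 * (n == 0%N)%:R) ->
  forall n, e n = 2 * (1 - 2 ^+ n.+1) * bernoulli_number R n.+1 / n.+1%:R.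
Proof.
move=> He; pose b n : R := 2 * (1 - 2 ^+ n.+1) * bernoulli_number R n.+1 / n.+1%:R.
have Hb n : b n + \sum_(k < n.+1) 'C(n, k)%:R * b k = 2 * (n == 0%N)%:R.
  have n0 : n.+1%:R != 0 :> R by rewrite pnatr_eq0.
  apply: (mulIf n0); rewrite mulrDl /b divfK// mulr_suml.
  have -> : \sum_(k < n.+1) 'C(n, k)%:R * (2 * (1 - 2 ^+ k.+1) *
      bernoulli_number R k.+1 / k.+1%:R) * n.+1%:R =
      \sum_(k < n.+2) 'C(n.+1, k)%:R *
        (2 * (1 - 2 ^+ k) * bernoulli_number R k).
    rewrite [RHS]big_ord_recl /= expr0 subrr !(mulr0, mul0r) add0r.
    apply: eq_bigr => k _; rewrite /bump /= add1n.
    have := mul_bin_diag n.+1 k; rewrite /= => /(congr1 (fun x => x%:R : R)).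
    rewrite !natrM => Hk.
    rewrite mulrAC [_ * n.+1%:R]mulrC Hk.
    by field; rewrite addrC natr1 pnatr_eq0.
  transitivity (2 * (1 - 2 ^+ n.+1) * bernoulli_number R n.+1 +
    2 * (\sum_(k < n.+2) 'C(n.+1, k)%:R * bernoulli_number R k -
     \sum_(k < n.+2) 'C(n.+1, k)%:R * (2 ^+ k * bernoulli_number R k))).
    rewrite -sumrB mulr_sumr; congr (_ + _); apply: eq_bigr => k _; ring.
  rewrite bernoulli_duplication big_ord_recr /= bernoulli_number_rec binn.
  by case: n {n0} => [|n] /=; ring.
suff : e =1 b by [].
move=> n; elim/ltn_ind: n => n IHn.
have := He n; rewrite -Hb !big_ord_recr /= binn !mul1r.
rewrite (eq_bigr (fun k : 'I_n => 'C(n, k)%:R * b k)); last by move=> k _; rewrite IHn.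
lra.
Qed.

(** * The logistic function and the numbers a_n *)

Definition sigmoid (R : realType) (t : R) : R := (1 + expR (- t))^-1.

(** The logistic equation sigma' = sigma - sigma^2 makes each derivative of
sigma a polynomial in sigma, given here by its recursion. *)
Fixpoint sigmoid_poly (R : realType) (n : nat) : {poly R} :=
  if n is m.+1 then (sigmoid_poly R m)^`() * ('X - 'X^2) else 'X.

Definition dsigmoid (R : realType) (n : nat) (t : R) : R :=
  (sigmoid_poly R n).[sigmoid R t].

Lemma sigmoid_den_gt0 (R : realType) (t : R) : 0 < 1 + expR (- t).
Proof. by rewrite ltr_wpDr ?expR_ge0. Qed.

Lemma sigmoid_gt0 (R : realType) (t : R) : 0 < sigmoid R t.
Proof. by rewrite invr_gt0 sigmoid_den_gt0. Qed.

Lemma sigmoid_le1 (R : realType) (t : R) : sigmoid R t <= 1.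
Proof.
rewrite /sigmoid -[leRHS]invr1 lef_pV2 ?posrE ?sigmoid_den_gt0//.
by rewrite lerDl expR_ge0.
Qed.

Lemma sigmoid_lt1 (R : realType) (t : R) : sigmoid R t < 1.
Proof. by rewrite /sigmoid invf_lt1 ?sigmoid_den_gt0// ltrDl expR_gt0. Qed.

Lemma is_derive_sigmoid (R : realType) (t : R) :
  is_derive t 1 (sigmoid R) (sigmoid R t - sigmoid R t ^+ 2).
Proof.
have d0 := lt0r_neq0 (sigmoid_den_gt0 R t).
have dN : is_derive t 1 (fun x : R => expR (- x)) (expR (- t) * -1).
  by apply: (is_derive1_comp (is_derive_expR (- t)) (is_deriveNid t (1 : R))).
have := is_deriveV (f := fun x => 1 + expR (- x)) d0
  (is_deriveD (is_derive_cst (1 : R) t 1) dN).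
move=> /is_derive_eq; apply.
by rewrite /GRing.scale /= /sigmoid; field.
Qed.

Lemma dsigmoid_chain (R : realType) : derivative_chain R (dsigmoid R).
Proof.
move=> n t; have := is_derive1_comp
  (is_derive_poly (sigmoid_poly R n) (sigmoid R t)) (is_derive_sigmoid R t).
by move=> /is_derive_eq; apply; rewrite /dsigmoid /= !hornerE.
Qed.

Lemma bounded_horner01 (R : realType) (p : {poly R}) :
  exists C : R, forall x, 0 <= x <= 1 -> `|p.[x]| <= C.
Proof.
exists (\sum_(i < size p) `|p`_i|) => x /andP[x0 x1].
rewrite horner_coef; apply: (le_trans (ler_norm_sum _ _ _)).
apply: ler_sum => i _; rewrite normrM (ger0_norm (exprn_ge0 _ x0)).
by rewrite ler_piMr// exprn_ile1.
Qed.

Lemma bounded_dsigmoid (R : realType) (n : nat) :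
  exists C : R, forall t, `|dsigmoid R n t| <= C.
Proof.
have [C HC] := bounded_horner01 R (sigmoid_poly R n).
by exists C => t; apply: HC; rewrite sigmoid_le1 ltW// sigmoid_gt0.
Qed.

(** The symmetry sigma(-t) = 1 - sigma(t), read on polynomials. Derivatives are
taken because the polynomial X itself is antisymmetric under X |-> 1 - X only up
to a constant. *)
Lemma sigmoid_poly_sym (R : realType) (n : nat) :
  (sigmoid_poly R n)^`() \Po (1 - 'X) = (-1) ^+ n *: (sigmoid_poly R n)^`().
Proof.
elim: n => [|n IHn]; first by rewrite derivX comp_polyC scale1r.
have /(congr1 (@deriv R)) : sigmoid_poly R n.+1 \Po (1 - 'X) =
    (-1) ^+ n *: sigmoid_poly R n.+1.
  rewrite /= comp_polyM IHn comp_polyB comp_polyX comp_Xn_poly -scalerAl.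
  by congr (_ *: (_ * _)); ring.
rewrite deriv_comp derivZ derivB derivC derivX sub0r mulrN1 exprS mulN1r scaleNr.
by move=> <-; rewrite opprK.
Qed.

(** At 0 the logistic function is 1/2, the fixed point of x |-> 1 - x, so the
symmetry kills the derivatives of even positive order. *)
Lemma dsigmoid_even0 (R : realType) (n : nat) : dsigmoid R n.*2.+2 0 = 0.
Proof.
have h : sigmoid R 0 = 2^-1 by rewrite /sigmoid oppr0 expR0.
have := congr1 (fun p => p.[2^-1]) (sigmoid_poly_sym R n.*2.+1).
rewrite horner_comp !hornerE exprS -signr_odd odd_double mulr1.
have -> : 1 - 2^-1 = 2^-1 :> R by field.
rewrite /dsigmoid /= h !hornerE => H.
suff -> : ((sigmoid_poly R n.*2)^`() * ('X - 'X^2))^`().[2^-1] = 0 by rewrite mul0r.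
by move: H => /=; lra.
Qed.

(** The derivatives of 2 / (1 + e^t) = 2 - 2 sigma(t). *)
Definition euler_chain (R : realType) (n : nat) (t : R) : R :=
  2 * (n == 0%N)%:R - 2 * dsigmoid R n t.

Lemma cst_chain (R : realType) (c : R) :
  derivative_chain R (fun n _ => c * (n == 0%N)%:R).
Proof. by move=> n x; rewrite mulr0; exact: is_derive_cst. Qed.

Lemma euler_chainP (R : realType) : derivative_chain R (euler_chain R).
Proof.
move=> n t.
exact: (is_deriveB (cst_chain R 2 n t) (is_deriveZ (2 : R) (dsigmoid_chain R n t))).
Qed.

Lemma euler_poly0E (R : realType) (n : nat) : euler_poly n (0 : R) = euler_chain R n 0.
Proof.
rewrite /euler_poly -(derive1n_chain R _ n (euler_chainP R)).
congr (derive1n n _ 0); apply/funext => t.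
rewrite /euler_chain /dsigmoid /= hornerX mulr0 expR0 /sigmoid expRN.
have e0 := expR_gt0 t.
by field; rewrite !lt0r_neq0// addr_gt0.
Qed.

(** Leibniz' rule for (1 + e^t) (2 / (1 + e^t)) = 2, at t = 0. *)
Lemma euler_number_rec (R : realType) (n : nat) :
  euler_poly n (0 : R) + \sum_(k < n.+1) 'C(n, k)%:R * euler_poly k (0 : R) =
  2 * (n == 0%N)%:R.
Proof.
have exp_chain : derivative_chain R (fun _ => expR) by move=> k x; exact: is_derive_expR.
have := leibniz_chain R _ _ (euler_chainP R) exp_chain => Lch.
pose G k t := euler_chain R k t +
  \sum_(i < k.+1) 'C(k, i)%:R * (euler_chain R i t * expR t).
have Gch : derivative_chain R G.
  by move=> k x; exact: is_deriveD (euler_chainP R k x) (Lch k x).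
have G0 : G 0%N = (fun _ => 2 * (0%N == 0%N)%:R).
  apply/funext => t; rewrite /G big_ord_recl big_ord0 addr0 bin0 mul1r.
  rewrite /euler_chain /dsigmoid /= hornerX /sigmoid expRN.
  have e0 := expR_gt0 t.
  by field; rewrite !lt0r_neq0// addr_gt0.
have := derive1n_chain R _ n Gch; rewrite G0 (derive1n_chain R _ n (cst_chain R 2)).
move=> /(congr1 (fun f => f 0)) ->; rewrite /G euler_poly0E.
by congr (_ + _); apply: eq_bigr => k _; rewrite expR0 mulr1 euler_poly0E.
Qed.

Lemma a_coefE (R : realType) (n : nat) : a_coef R n = - dsigmoid R n.*2.+1 0.
Proof. by rewrite /a_coef euler_poly0E mul2n /euler_chain /=; field. Qed.

Lemma a_coef_bernoulli (R : realType) (n : nat) :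
  a_coef R n = (1 - 2 ^+ (2 * n + 2)) * bernoulli_number R (2 * n + 2)
                 / (2 * n + 2)%:R.
Proof.
rewrite /a_coef (euler_number_unique R (fun k => euler_poly k (0 : R))).
  by rewrite addn2; move: (2 * n).+1 => m; field; rewrite addrC natr1 pnatr_eq0.
exact: euler_number_rec.
Qed.

(** The derivatives of g = sigma sigma', which is (sigma' - sigma'') / 2 because
sigma^2 = sigma - sigma'. *)
Definition sigmoid_weight (R : realType) (i : nat) (v : R) : R :=
  2^-1 * (dsigmoid R i.+1 v - dsigmoid R i.+2 v).

Lemma sigmoid_weight_chain (R : realType) : derivative_chain R (sigmoid_weight R).
Proof.
move=> n t; exact: (is_deriveZ (2^-1 : R)
  (is_deriveB (dsigmoid_chain R n.+1 t) (dsigmoid_chain R n.+2 t))).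
Qed.

Lemma sigmoid_weight0E (R : realType) (v : R) :
  sigmoid_weight R 0 v = sigmoid R v ^+ 2 * (1 - sigmoid R v).
Proof.
rewrite /sigmoid_weight /dsigmoid /= !(derivM, derivB, derivX, derivXn, derivC).
by rewrite !hornerE; field.
Qed.

Lemma sigmoid_weight0_ge0 (R : realType) (v : R) : 0 <= sigmoid_weight R 0 v.
Proof. by rewrite sigmoid_weight0E mulr_ge0 ?sqr_ge0// subr_ge0 sigmoid_le1. Qed.

Lemma bounded_sigmoid_weight (R : realType) (n : nat) :
  exists C : R, forall t, `|sigmoid_weight R n t| <= C.
Proof.
have [C HC] := bounded_dsigmoid R n.+1; have [D HD] := bounded_dsigmoid R n.+2.
exists (2^-1 * (C + D)) => t; rewrite normrM ger0_norm// ler_wpM2l//.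
by apply: (le_trans (ler_normB _ _)); rewrite lerD.
Qed.

(** One of the orders i + 1 and i + 2 is even and contributes nothing. The index
i.+1./2 is the floor of (j - 1) / 2 for j = i + 2. *)
Lemma sigmoid_weight_at0 (R : realType) (i : nat) :
  sigmoid_weight R i 0 = (-1) ^+ i.+1 * a_coef R i.+1./2 / 2.
Proof.
rewrite /sigmoid_weight a_coefE -signr_odd -[X in dsigmoid R X.+1 _ - _](odd_double_half i).
rewrite -[X in _ - dsigmoid R X.+2 _](odd_double_half i) /= uphalf_half.
case: (odd i); rewrite /= ?add1n ?add0n ?doubleS dsigmoid_even0.
  by field.
by field.
Qed.

(** * Multiple harmonic sums *)

(** The multiple harmonic sum of 1 / (n_1 ... n_m) over
n >= n_1 > ... > n_m >= 1. *)
Fixpoint mult_harmonic (R : realType) (m n : nat) : R :=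
  if m is m'.+1 then \sum_(x < n) mult_harmonic R m' x / x.+1%:R else 1.

Definition decreasing_tuple (N m : nat) (t : m.-tuple 'I_N) : bool :=
  [forall a : 'I_m, forall b : 'I_m,
     (a < b)%N ==> (tnth t b < tnth t a)%N].

Lemma decreasing_tuple_cons (N m : nat) (x : 'I_N) (t : m.-tuple 'I_N) :
  decreasing_tuple N m.+1 [tuple of x :: t] =
  all (fun y : 'I_N => (y < x)%N) t && decreasing_tuple N m t.
Proof.
apply/forallP/andP => [H|[/all_tnthP xt /forallP ht] a].
  split.
    apply/all_tnthP => i; have /forallP/(_ (lift ord0 i)) := H ord0.
    by rewrite tnth0 tnthS.
  apply/forallP => a; apply/forallP => b; apply/implyP => ab.
  have /forallP/(_ (lift ord0 b)) := H (lift ord0 a).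
  by rewrite !tnthS /= /bump /= !add1n ltnS ab.
apply/forallP => b; apply/implyP.
case: (unliftP ord0 b) => [b'|] ->; last by [].
case: (unliftP ord0 a) => [a'|] -> ab; rewrite ?tnth0 !tnthS; last exact: xt.
have /forallP/(_ b')/implyP := ht a'; apply.
by move: ab; rewrite /= /bump /= !add1n ltnS.
Qed.

Lemma big_tuple_cons (R : realType) (T : finType) (m : nat)
    (P : pred (m.+1.-tuple T)) (F : m.+1.-tuple T -> R) :
  \sum_(t : m.+1.-tuple T | P t) F t =
  \sum_(x : T) \sum_(t : m.-tuple T | P [tuple of x :: t]) F [tuple of x :: t].
Proof.
rewrite pair_big_dep /=.
rewrite (reindex (fun p : T * m.-tuple T => [tuple of p.1 :: p.2])) //=.
exists (fun t => (thead t, [tuple of behead t])) => [[x t] _|t _] /=.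
  by congr pair; apply: val_inj.
by rewrite -tuple_eta.
Qed.

(** The entries stay in 'I_N, and the bound b on them is a separate condition, so
that removing the largest entry only changes b. *)
Lemma sum_decreasing_tuple (R : realType) (m N b : nat) : (b <= N)%N ->
  \sum_(t : m.-tuple 'I_N |
      all (fun y : 'I_N => (y < b)%N) t && decreasing_tuple N m t)
    \prod_(i < m) ((tnth t i).+1%:R)^-1 = mult_harmonic R m b.
Proof.
elim: m b => [|m IHm] b bN.
  rewrite (big_pred1 [tuple]) ?big_ord0// => t; rewrite [t]tuple0.
  transitivity true; last by apply/esym/eqP.
  by apply/forallP => -[].
rewrite big_tuple_cons.
transitivity (\sum_(x < N | (x < b)%N) mult_harmonic R m x / x.+1%:R); last first.
  by rewrite /= (big_ord_widen N (fun x => mult_harmonic R m x / x.+1%:R) bN).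
rewrite [RHS]big_mkcond; apply: eq_bigr => x _ /=.
have [xb|xb] := ltnP x b; last by rewrite big_pred0.
rewrite -(IHm x (ltnW (ltn_ord x))) mulr_suml; apply: eq_big => [t|t _].
  rewrite decreasing_tuple_cons andbA; congr (_ && _); apply/andP/idP => [[]//|xt].
  by split => //; apply: sub_all xt => y /= /ltn_trans; exact.
rewrite big_ord_recl tnth0 mulrC; congr (_ * _).
by apply: eq_bigr => i _; rewrite tnthS.
Qed.

Lemma alt_mzv_partialE (R : realType) (j m N : nat) :
  alt_mzv_partial R j m N =
  \sum_(x < N) (-1) ^+ x.+1 / x.+1%:R ^+ j * mult_harmonic R m x.
Proof.
rewrite /alt_mzv_partial (big_tuple_cons R).
apply: eq_bigr => x _; rewrite -(sum_decreasing_tuple R m N x (ltnW (ltn_ord x))).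
rewrite mulr_sumr; apply: eq_big => [t|t _]; first exact: decreasing_tuple_cons.
by rewrite tnth0; congr (_ * _); apply: eq_bigr => i _; rewrite tnthS.
Qed.

Lemma mult_harmonic_ge0 (R : realType) (m n : nat) : 0 <= mult_harmonic R m n.
Proof.
elim: m n => //= m IHm n; apply: sumr_ge0 => i _.
by rewrite divr_ge0.
Qed.

(** The quotient for m + 1 is dominated by the Cesaro mean of the quotients
for m. *)
Lemma cvg_mult_harmonic (R : realType) (m : nat) :
  (fun n => mult_harmonic R m n / n.+1%:R) @ \oo --> (0 : R).
Proof.
elim: m => [|m IHm] /=.
  by under eq_fun do rewrite div1r; exact: cvg_harmonic.
have := cesaro IHm; apply: (@squeeze_cvgr _ _ _ _ (cst 0)); last exact: cvg_cst.
apply: nearW => n; apply/andP; split.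
  by rewrite divr_ge0// (mult_harmonic_ge0 R m.+1 n).
rewrite /arithmetic_mean /= seriesEord /= mulrC ler_wpM2l ?invr_ge0//.
rewrite [leRHS]big_ord_recr /= lerDl.
by rewrite divr_ge0// mult_harmonic_ge0.
Qed.

(** * Expansion of the powers of ln(1 + y) *)

(** The Taylor polynomial of order N of ln (1 + y)^m / m! at 0. *)
Definition ln1p_power_poly (R : realType) (N m : nat) (y : R) : R :=
  if m is k.+1 then
    (-1) ^+ k.+1 * \sum_(x < N) mult_harmonic R k x / x.+1%:R * (- y) ^+ x.+1
  else 1.

Definition dln1p_power_poly (R : realType) (N k : nat) (y : R) : R :=
  (-1) ^+ k * \sum_(x < N) mult_harmonic R k x * (- y) ^+ x.

Lemma is_derive_ln1p_power_poly (R : realType) (N k : nat) (y : R) :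
  is_derive y 1 (ln1p_power_poly R N k.+1) (dln1p_power_poly R N k y).
Proof.
have -> : ln1p_power_poly R N k.+1 = (-1) ^+ k.+1 \*:
   \sum_(x < N) ((mult_harmonic R k x / x.+1%:R) \*: ((-%R : R -> R) ^+ x.+1)).
  apply/funext => z; rewrite /ln1p_power_poly /=; congr (_ * _).
  by rewrite fct_sumE; apply: eq_bigr => x _; rewrite fctE.
have := is_deriveZ ((-1) ^+ k.+1) (is_derive_sum (fun x : 'I_N =>
  is_deriveZ (mult_harmonic R k x / x.+1%:R) (is_deriveX x.+1 (is_deriveNid y (1 : R))))).
move=> /is_derive_eq; apply.
rewrite /dln1p_power_poly /GRing.scale /= exprS mulN1r mulNr -mulrN -sumrN.
congr (_ * _); apply: eq_bigr => x _.
by field; rewrite addrC natr1 pnatr_eq0.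
Qed.

(** The functions F_m = ln (1 + y)^m / m! satisfy (1 + y) F_(m+1)' = F_m. Their
Taylor polynomials do so up to one term of degree N, by summation by parts. *)
Lemma dln1p_power_polyE (R : realType) (N k : nat) (y : R) :
  (1 + y) * dln1p_power_poly R N k y =
  ln1p_power_poly R N k y - (-1) ^+ k * (- y) ^+ N * mult_harmonic R k N.
Proof.
rewrite /dln1p_power_poly; elim: N => [|N IHN].
  rewrite big_ord0 !mulr0 /ln1p_power_poly.
  by case: k => [|k] /=; rewrite ?big_ord0 ?expr0; ring.
rewrite big_ord_recr /= 2!mulrDr IHN /ln1p_power_poly.
case: k {IHN} => [|k] /=; first by rewrite exprS; ring.
rewrite ![in RHS]big_ord_recr /= !exprS; ring.
Qed.

Definition ln1p_power_err (R : realType) (m N : nat) : R :=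
  \sum_(i < m) mult_harmonic R i N / N.+1%:R.

Lemma ln1p_power_err_ge0 (R : realType) (m N : nat) : 0 <= ln1p_power_err R m N.
Proof. by apply: sumr_ge0 => i _; rewrite divr_ge0// mult_harmonic_ge0. Qed.

Lemma cvg_ln1p_power_err (R : realType) (m : nat) :
  ln1p_power_err R m @ \oo --> (0 : R).
Proof.
rewrite /ln1p_power_err; elim: m => [|m IHm].
  by under eq_fun do rewrite big_ord0; exact: cvg_cst.
under eq_fun do rewrite big_ord_recr /=.
by have := cvgD IHm (cvg_mult_harmonic R m); rewrite addr0; exact.
Qed.

Lemma is_derive_ln1p (R : realType) (y : R) : 0 <= y ->
  is_derive y 1 (fun z => ln (1 + z)) (1 + y)^-1.
Proof.
move=> y0; have y1 : 0 < 1 + y by rewrite ltr_wpDr.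
have := is_derive1_comp (is_derive1_ln y1)
  (is_deriveD (is_derive_cst (1 : R) y 1) (is_derive_id y 1)).
by move=> /is_derive_eq; apply; rewrite add0r mulr1.
Qed.

(** The derivative of the error for m + 1 is the error for m plus a term
y^N mult_harmonic m N, divided by 1 + y >= 1; integrating from 0 gives the bound
by induction. Its factor y becomes e^-s below and makes the error integrable. *)
Lemma ln1p_power_polyP (R : realType) (m N : nat) (y : R) : 0 <= y <= 1 ->
  `|ln (1 + y) ^+ m / m`!%:R - ln1p_power_poly R N m y| <=
  y * ln1p_power_err R m N.
Proof.
elim: m y => [|m IHm] y /andP[y0 y1].
  by rewrite expr0 fact0 divr1 subrr normr0 mulr_ge0// ln1p_power_err_ge0.
pose e := ln1p_power_err R m N.
pose c := mult_harmonic R m N.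
pose f z := ln (1 + z) ^+ m.+1 / m.+1`!%:R - ln1p_power_poly R N m.+1 z.
pose f' z := (1 + z)^-1 * (ln (1 + z) ^+ m / m`!%:R) - dln1p_power_poly R N m z.
pose b z := e * z + c / N.+1%:R * z ^+ N.+1.
pose b' z := e + c * z ^+ N.
have f0 : f 0 = 0.
  rewrite /f addr0 ln1 expr0n /= mul0r /ln1p_power_poly big1 ?mulr0 ?subrr//.
  by move=> i _; rewrite oppr0 expr0n mulr0.
have b0 : b 0 = 0 by rewrite /b expr0n !mulr0 addr0.
have e0 : 0 <= e by exact: ln1p_power_err_ge0.
have c0 : 0 <= c by exact: mult_harmonic_ge0.
have := derivative_domination R f f' b b' y y0.
rewrite f0 b0 !subr0 => H.
apply: (le_trans (H _)); last first.
  rewrite /b /ln1p_power_err big_ord_recr /= -/c -/(ln1p_power_err R m N) -/e.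
  rewrite mulrDr [y * e]mulrC lerD2l mulrC ler_wpM2r ?divr_ge0//.
  by rewrite exprS ler_piMr// exprn_ile1.
move=> t /andP[t0 ty].
have t1 : 0 < 1 + t by rewrite ltr_wpDr.
split.
- have := is_deriveB (is_deriveZ (m.+1`!%:R^-1 : R)
    (is_deriveX m.+1 (is_derive_ln1p R t t0))) (is_derive_ln1p_power_poly R N m t).
  have -> : m.+1`!%:R^-1 \*: (fun z => ln (1 + z)) ^+ m.+1 - ln1p_power_poly R N m.+1 = f.
    by apply/funext => z; rewrite /f !fctE /GRing.scale /=; congr (_ - _); rewrite mulrC.
  move=> /is_derive_eq; apply; rewrite /f'; congr (_ - _).
  rewrite /GRing.scale /= factS natrM; field.
  by rewrite [1 + m%:R]addrC natr1 !pnatr_eq0 -lt0n fact_gt0 (lt0r_neq0 t1).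
- have := is_deriveD (is_deriveZ e (is_derive_id t (1 : R)))
    (is_deriveZ (c / N.+1%:R) (is_deriveX N.+1 (is_derive_id t (1 : R)))).
  have -> : e \*: id + (c / N.+1%:R) \*: id ^+ N.+1 = b.
    by apply/funext => z; rewrite /b !fctE.
  move=> /is_derive_eq; apply; rewrite /b' /GRing.scale /=.
  by field; rewrite addrC natr1 pnatr_eq0.
have -> : f' t = (1 + t)^-1 * ((ln (1 + t) ^+ m / m`!%:R - ln1p_power_poly R N m t)
    + (-1) ^+ m * (- t) ^+ N * c).
  have := dln1p_power_polyE R N m t; rewrite /f' => HP.
  have -> : dln1p_power_poly R N m t = (1 + t)^-1 * ((1 + t) * dln1p_power_poly R N m t).
    by rewrite mulKf// lt0r_neq0.
  by rewrite HP -/c; ring.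
rewrite normrM gtr0_norm ?invr_gt0//.
rewrite -[b' t]mul1r ler_pM// ?invr_ge0 ?(ltW t1)//.
  by rewrite invf_le1// lerDl.
rewrite (le_trans (ler_normD _ _))// lerD//.
  apply: (le_trans (IHm t _)); first by rewrite t0 (le_trans ty).
  by rewrite ler_piMl// (le_trans ty).
by rewrite !normrM normrX normrN1 expr1n mul1r normrX normrN (ger0_norm t0) (ger0_norm c0) mulrC.
Qed.

(** * Integrals over the half-line *)

Lemma ler_exprn_expR (R : realType) (k : nat) (y : R) :
  0 <= y -> y ^+ k <= k`!%:R * expR y.
Proof.
move=> y0; case: k => [|k].
  by rewrite expr0 fact0 mul1r -expR0 ler_expR.
rewrite mulrC -ler_pdivrMr ?ltr0n ?fact_gt0//.
by apply: le_trans (expR_ge1Dxn k y0); rewrite lerDr.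
Qed.

(** Half of the exponential decay absorbs the power of s. *)
Lemma ler_exprn_expR_half (R : realType) (k : nat) (c s : R) : 0 < c -> 0 <= s ->
  s ^+ k * expR (- (c * s)) <= k`!%:R * (2 / c) ^+ k * expR (- (c / 2 * s)).
Proof.
move=> c0 s0.
have c2 : 0 < c / 2 by rewrite divr_gt0.
have := ler_exprn_expR R k (c / 2 * s) (mulr_ge0 (ltW c2) s0).
have -> : expR (c / 2 * s) = expR (- (c / 2 * s)) / expR (- (c * s)).
  by rewrite -expRN -expRD; congr expR; field.
rewrite mulrA ler_pdivlMr ?expR_gt0// => H.
have -> : s ^+ k = (2 / c) ^+ k * (c / 2 * s) ^+ k.
  by rewrite -exprMn; congr (_ ^+ _); field; rewrite lt0r_neq0.
rewrite [_ * (2 / c) ^+ k]mulrC -[leLHS]mulrA -[leRHS]mulrA ler_wpM2l//.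
by rewrite exprn_ge0// divr_ge0// ltW.
Qed.

(** Repeated integration by parts of s^k e^(-c s). *)
Fixpoint moment_primitive (R : realType) (c : R) (k : nat) (s : R) : R :=
  if k is j.+1 then
    (- c^-1) * (s ^+ j.+1 * expR (- (c * s))) + j.+1%:R / c * moment_primitive R c j s
  else (- c^-1) * expR (- (c * s)).

Lemma is_derive_expRNM (R : realType) (c s : R) :
  is_derive s 1 (fun s => expR (- (c * s))) (- c * expR (- (c * s))).
Proof.
have := @is_derive1_comp R expR (fun s => - (c * s)) s _ _ (is_derive_expR _)
  (is_deriveN (is_deriveZ c (is_derive_id s (1 : R)))).
by move=> /is_derive_eq; apply; rewrite /GRing.scale /= mulr1 mulrC.
Qed.

Lemma is_derive_exprn_expR (R : realType) (k : nat) (c s : R) :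
  is_derive s 1 (fun s => s ^+ k.+1 * expR (- (c * s)))
   (k.+1%:R * s ^+ k * expR (- (c * s)) - c * (s ^+ k.+1 * expR (- (c * s)))).
Proof.
have := is_deriveM (is_deriveX k.+1 (is_derive_id s (1 : R))) (is_derive_expRNM R c s).
have -> : (id ^+ k.+1 * (fun s0 : R => expR (- (c * s0)))) =
    (fun s => s ^+ k.+1 * expR (- (c * s))).
  by apply/funext => x; rewrite !fctE.
move=> /is_derive_eq; apply; rewrite !fctE /GRing.scale /=; ring.
Qed.

Lemma is_derive_moment_primitive (R : realType) (c : R) (k : nat) (s : R) : c != 0 ->
  is_derive s 1 (moment_primitive R c k) (s ^+ k * expR (- (c * s))).
Proof.
move=> c0; elim: k => [|k IHk] /=.
  have := is_deriveZ (- c^-1) (is_derive_expRNM R c s).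
  by move=> /is_derive_eq; apply; rewrite /GRing.scale /= expr0; field.
have := is_deriveD (is_deriveZ (- c^-1) (is_derive_exprn_expR R k c s))
  (is_deriveZ (k.+1%:R / c) IHk).
by move=> /is_derive_eq; apply; rewrite /GRing.scale /=; field.
Qed.

Lemma moment_primitive0 (R : realType) (c : R) (k : nat) : c != 0 ->
  moment_primitive R c k 0 = - (k`!%:R / c ^+ k.+1).
Proof.
move=> c0; elim: k => [|k IHk] /=.
  by rewrite mulr0 oppr0 expR0 fact0; field.
by rewrite IHk expr0n mul0r mulr0 add0r factS natrM !exprS; field; rewrite c0 expf_neq0.
Qed.

Lemma cvg_expRNM (R : realType) (c : R) : 0 < c ->
  expR (- (c * s)) @[s --> +oo] --> (0 : R).
Proof.
move=> c0; apply: (@cvg_comp _ _ _ (fun s => c * s) (fun s => expR (- s)) _ +oo).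
  by apply: gt0_cvgMry => //; exact: cvg_id.
exact: cvgr_expR.
Qed.

Lemma cvg_exprn_expRNM (R : realType) (k : nat) (c : R) : 0 < c ->
  s ^+ k * expR (- (c * s)) @[s --> +oo] --> (0 : R).
Proof.
move=> c0; have c2 : 0 < c / 2 by rewrite divr_gt0.
apply: (@squeeze_cvgr _ _ _ _ (cst 0)
   (fun s => k`!%:R * (2 / c) ^+ k * expR (- (c / 2 * s)))).
- near=> s; have s0 : 0 <= s by near: s; exact: nbhs_pinfty_ge.
  by rewrite mulr_ge0 ?exprn_ge0 ?expR_ge0//= ler_exprn_expR_half.
- exact: cvg_cst.
- rewrite -[X in _ --> X](mulr0 (k`!%:R * (2 / c) ^+ k)).
  by apply: cvgMl_tmp; exact: cvg_expRNM.
Unshelve. all: by end_near. Qed.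

Lemma cvg_moment_primitive (R : realType) (c : R) (k : nat) : 0 < c ->
  moment_primitive R c k s @[s --> +oo] --> (0 : R).
Proof.
move=> c0; elim: k => [|k IHk] /=.
  rewrite -[X in _ --> X](mulr0 (- c^-1)).
  by apply: cvgMl_tmp; exact: cvg_expRNM.
rewrite -[X in _ --> X](addr0 0); apply: cvgD.
  rewrite -[X in _ --> X](mulr0 (- c^-1)).
  by apply: cvgMl_tmp; exact: cvg_exprn_expRNM.
by rewrite -[X in _ --> X](mulr0 (k.+1%:R / c)); apply: cvgMl_tmp.
Qed.

Lemma integral_halfline_primitive (R : realType) (f F : R -> R) (l : R) :
  continuous f -> (forall s, 0 <= s -> 0 <= f s) ->
  (forall s : R, 0 <= s -> is_derive s 1 F (f s)) -> F s @[s --> +oo] --> l ->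
  (\int[mu]_(s in `[0%R, +oo[) (f s)%:E = l%:E - (F 0)%:E)%E.
Proof.
move=> cf f0 dF Fl; apply: ge0_continuous_FTC2y => //.
- exact: continuous_subspaceT.
- by move=> s s0; exact: (@ex_derive _ _ _ _ _ _ _ (dF s (ltW s0))).
- apply: cvg_at_right_filter; apply: differentiable_continuous.
  by apply/derivable1_diffP; exact: (@ex_derive _ _ _ _ _ _ _ (dF 0 (lexx 0))).
- move=> s; rewrite in_itv /= andbT => s0.
  by rewrite derive1E; case: (dF s (ltW s0)).
Qed.

Lemma continuous_exprn_expRNM (R : realType) (k : nat) (c : R) :
  continuous (fun s : R => s ^+ k * expR (- (c * s))).
Proof.
case: k => [|k].
  under eq_fun do rewrite expr0 mul1r.
  exact: (is_derive_continuous R _ _ (is_derive_expRNM R c)).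
exact: (is_derive_continuous R _ _ (is_derive_exprn_expR R k c)).
Qed.

Lemma integral_exprn_expRNM (R : realType) (k : nat) (c : R) : 0 < c ->
  (\int[mu]_(s in `[0%R, +oo[) (s ^+ k * expR (- (c * s)))%:E =
   (k`!%:R / c ^+ k.+1)%:E)%E.
Proof.
move=> c0; have cn0 := lt0r_neq0 c0.
have f0 (s : R) : 0 <= s -> 0 <= s ^+ k * expR (- (c * s)).
  by move=> s0; rewrite mulr_ge0 ?exprn_ge0 ?expR_ge0.
have dF (s : R) (_ : 0 <= s) := is_derive_moment_primitive R c k s cn0.
rewrite (integral_halfline_primitive R _ _ _ (continuous_exprn_expRNM R k c) f0 dF
  (cvg_moment_primitive R c k c0)).
by rewrite moment_primitive0// -EFinD sub0r opprK.
Qed.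

Lemma integrable_exprn_expRNM (R : realType) (k : nat) (c : R) : 0 < c ->
  mu.-integrable `[0%R, +oo[ (EFin \o (fun s : R => s ^+ k * expR (- (c * s)))).
Proof.
move=> c0; apply/integrableP; split.
  apply/measurable_EFinP; apply: measurable_funTS.
  by apply: continuous_measurable_fun; exact: continuous_exprn_expRNM.
under eq_integral => s.
  rewrite inE /= in_itv /= andbT => s0.
  rewrite ger0_norm ?mulr_ge0 ?exprn_ge0 ?expR_ge0//.
  over.
by rewrite integral_exprn_expRNM// ltry.
Qed.

Lemma integrable_scale_exprn_expRNM (R : realType) (a : R) (k : nat) (c : R) : 0 < c ->
  mu.-integrable `[0%R, +oo[ (EFin \o (fun s : R => a * (s ^+ k * expR (- (c * s))))).
Proof.
move=> c0; apply: (@integrableZl _ _ _ mu _ _ a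
  (EFin \o (fun s : R => s ^+ k * expR (- (c * s))))) => //.
exact: integrable_exprn_expRNM.
Qed.

Lemma Rintegral_exprn_expRNM (R : realType) (k : nat) (c : R) : 0 < c ->
  \int[mu]_(s in `[0%R, +oo[) (s ^+ k * expR (- (c * s))) = k`!%:R / c ^+ k.+1.
Proof. by move=> c0; rewrite /Rintegral integral_exprn_expRNM. Qed.

Lemma integrable_dominated (R : realType) (f : R -> R) (k : nat) (c C : R) :
  0 < c -> measurable_fun setT f ->
  (forall s, 0 <= s -> `|f s| <= C * (s ^+ k * expR (- (c * s)))) ->
  mu.-integrable `[0%R, +oo[ (EFin \o f).
Proof.
move=> c0 mf fC.
apply: (le_integrable _ _ _ (integrable_scale_exprn_expRNM R C k c c0)) => //.
- by apply/measurable_EFinP; exact: measurable_funTS.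
- move=> s; rewrite /= in_itv /= andbT => s0.
  by rewrite lee_fin; apply: (le_trans (fC s s0)); exact: ler_norm.
Qed.

Lemma Rintegral_dominated (R : realType) (f : R -> R) (k : nat) (c C : R) :
  0 < c -> measurable_fun setT f ->
  (forall s, 0 <= s -> `|f s| <= C * (s ^+ k * expR (- (c * s)))) ->
  `|\int[mu]_(s in `[0%R, +oo[) f s| <= C * (k`!%:R / c ^+ k.+1).
Proof.
move=> c0 mf fC; have fi := integrable_dominated R f k c C c0 mf fC.
have m1 := integrable_exprn_expRNM R k c c0.
apply: (le_trans (le_normr_Rintegral _ fi)) => //.
have -> : C * (k`!%:R / c ^+ k.+1) =
    \int[mu]_(s in `[0%R, +oo[) (C * (s ^+ k * expR (- (c * s)))).
  by rewrite RintegralZl// Rintegral_exprn_expRNM.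
apply: le_Rintegral => //.
- exact: integrable_norm.
- exact: integrable_scale_exprn_expRNM.
- by move=> s; rewrite /= in_itv /= andbT => s0; rewrite fC.
Qed.

Lemma Rintegral_sum (R : realType) (n : nat) (f : 'I_n -> R -> R) :
  (forall i, mu.-integrable `[0%R, +oo[ (EFin \o f i)) ->
  \int[mu]_(s in `[0%R, +oo[) (\sum_(i < n) f i s) =
  \sum_(i < n) \int[mu]_(s in `[0%R, +oo[) f i s.
Proof.
move=> fi; apply: EFin_inj; rewrite -sumEFin.
under [RHS]eq_bigr => i _.
  rewrite /Rintegral fineK; last by apply: integrable_fin_num => //; exact: fi.
  over.
rewrite -integral_sum// /Rintegral fineK.
  by apply: eq_integral => s _; rewrite sumEFin.
under eq_integral do rewrite -sumEFin.
apply: integrable_fin_num => //.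
by apply: integrable_sum => // i _; exact: fi.
Qed.

(** * Alternating multiple zeta values as moments *)

Definition ln1pexp (R : realType) (s : R) : R := ln (1 + expR (- s)).

Lemma ln1pexp_ge0 (R : realType) (s : R) : 0 <= ln1pexp R s.
Proof. by rewrite ln_ge0// lerDl expR_ge0. Qed.

Lemma ln1pexp_le (R : realType) (s : R) : ln1pexp R s <= expR (- s).
Proof. by apply: le_ln1Dx; apply: lt_le_trans (expR_ge0 _); rewrite ltrN10. Qed.

Lemma ln1pexp_le1 (R : realType) (s : R) : 0 <= s -> ln1pexp R s <= 1.
Proof.
move=> s0; apply: (le_trans (ln1pexp_le R s)).
by rewrite -expR0 ler_expR oppr_le0.
Qed.

Lemma ln1pexp_pow_le (R : realType) (m : nat) (s : R) : 0 <= s ->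
  ln1pexp R s ^+ m.+1 <= expR (- s).
Proof.
move=> s0; apply: le_trans (ln1pexp_le R s).
by rewrite exprS ler_piMr ?ln1pexp_ge0// exprn_ile1 ?ln1pexp_ge0 ?ln1pexp_le1.
Qed.

Lemma measurable_ln1pexp (R : realType) : measurable_fun setT (ln1pexp R).
Proof.
apply: (@measurableT_comp _ _ _ _ _ _ (@ln R)) => //.
apply: measurable_funD => //.
by apply: (@measurableT_comp _ _ _ _ _ _ (@expR R)).
Qed.

Definition ln1pexp_moment (R : realType) (k m : nat) : R :=
  \int[mu]_(s in `[0%R, +oo[) (s ^+ k * (ln1pexp R s ^+ m / m`!%:R)).

Lemma measurable_exprn_ln1pexp (R : realType) (k m : nat) :
  measurable_fun setT (fun s : R => s ^+ k * (ln1pexp R s ^+ m / m`!%:R)).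
Proof.
apply: measurable_funM; first exact: measurable_funX.
by apply: measurable_funM => //; apply: measurable_funX; exact: measurable_ln1pexp.
Qed.

Lemma integrable_exprn_ln1pexp (R : realType) (k m : nat) : 
  mu.-integrable `[0%R, +oo[ (EFin \o (fun s : R =>
     s ^+ k * (ln1pexp R s ^+ m.+1 / m.+1`!%:R))).
Proof.
apply: (integrable_dominated R _ k 1 1 ltr01).
  exact: measurable_exprn_ln1pexp.
move=> s s0; rewrite !mul1r ger0_norm; last first.
  by rewrite !mulr_ge0 ?exprn_ge0 ?ln1pexp_ge0.
rewrite ler_wpM2l ?exprn_ge0// (le_trans _ (ln1pexp_pow_le R m s s0))//.
by rewrite ler_piMr ?exprn_ge0 ?ln1pexp_ge0// invf_le1 ?ltr0n ?fact_gt0// ler1n fact_gt0.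
Qed.

Lemma Rintegral_ln1p_power_poly (R : realType) (k m N : nat) :
  mu.-integrable `[0%R, +oo[ (EFin \o (fun s : R =>
    s ^+ k * ln1p_power_poly R N m.+1 (expR (- s)))) /\
  \int[mu]_(s in `[0%R, +oo[) (s ^+ k * ln1p_power_poly R N m.+1 (expR (- s))) =
  (-1) ^+ m.+1 * k`!%:R * alt_mzv_partial R k.+2 m N.
Proof.
pose c (x : 'I_N) : R := (-1) ^+ m.+1 * (mult_harmonic R m x / x.+1%:R * (-1) ^+ x.+1).
have E : (fun s : R => s ^+ k * ln1p_power_poly R N m.+1 (expR (- s))) =
    (fun s => \sum_(x < N) c x * (s ^+ k * expR (- (x.+1%:R * s)))).
  apply/funext => s; rewrite /ln1p_power_poly !mulr_sumr; apply: eq_bigr => x _.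
  by rewrite -mulrN expRM_natl [(- expR _) ^+ _]exprNn /c; ring.
have ci (x : 'I_N) : mu.-integrable `[0%R, +oo[ (EFin \o
    (fun s : R => c x * (s ^+ k * expR (- (x.+1%:R * s))))).
  exact: integrable_scale_exprn_expRNM.
split.
  have -> : EFin \o (fun s : R => s ^+ k * ln1p_power_poly R N m.+1 (expR (- s))) =
      (fun s => \sum_(x < N) (c x * (s ^+ k * expR (- (x.+1%:R * s))))%:E)%E.
    by rewrite E; apply/funext => s; rewrite sumEFin.
  by apply: integrable_sum => // x _; exact: ci.
rewrite E Rintegral_sum// alt_mzv_partialE mulr_sumr; apply: eq_bigr => x _.
have x0 : (0 : R) < x.+1%:R by rewrite ltr0n.
rewrite RintegralZl//; last exact: integrable_exprn_expRNM.
rewrite Rintegral_exprn_expRNM// /c !exprS; field.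
by rewrite addrC natr1 pnatr_eq0 expf_neq0.
Qed.

(** Multiplied by (-1)^(m+1) k!, the partial sum is the integral of s^k times the
Taylor polynomial at y = e^-s, and the error integrates to at most k! times a
null sequence. *)
Lemma cvg_alt_mzv_partial (R : realType) (k m : nat) :
  alt_mzv_partial R k.+2 m @ \oo --> (-1) ^+ m.+1 / k`!%:R * ln1pexp_moment R k m.+1.
Proof.
have kf : k`!%:R != 0 :> R by rewrite pnatr_eq0 -lt0n fact_gt0.
suff H : (fun N => (-1) ^+ m.+1 * k`!%:R * alt_mzv_partial R k.+2 m N) @ \oo -->
    ln1pexp_moment R k m.+1.
  have -> : alt_mzv_partial R k.+2 m = (fun N => (-1) ^+ m.+1 / k`!%:R *
      ((-1) ^+ m.+1 * k`!%:R * alt_mzv_partial R k.+2 m N)).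
    apply/funext => N; rewrite mulrA mulrACA -exprMn mulrNN mulr1 expr1n mulVf// mulr1 mul1r.
    by [].
  by apply: cvgMl_tmp.
apply/cvgrPdist_le => /= e e0.
have /cvgrPdist_le/(_ (e / k`!%:R)) := cvg_ln1p_power_err R m.+1.
have ek : 0 < e / k`!%:R by rewrite divr_gt0// ltr0n fact_gt0.
move=> /(_ ek); apply: filterS => N; rewrite sub0r normrN ger0_norm ?ln1p_power_err_ge0//.
move=> errN; have [Pint PE] := Rintegral_ln1p_power_poly R k m N.
rewrite -PE /ln1pexp_moment -RintegralB//; last exact: integrable_exprn_ln1pexp.
rewrite -[e](divfK kf).
apply: (le_trans (Rintegral_dominated R _ k 1 (ln1p_power_err R m.+1 N) ltr01 _ _)).
- apply: measurable_funB; first exact: measurable_exprn_ln1pexp.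
  apply: measurable_funM; first exact: measurable_funX.
  apply: (@measurableT_comp _ _ _ _ _ _ (ln1p_power_poly R N m.+1)).
    apply: continuous_measurable_fun.
    exact: (is_derive_continuous R _ _ (is_derive_ln1p_power_poly R N m)).
  by apply: (@measurableT_comp _ _ _ _ _ _ (@expR R)).
- move=> s s0; rewrite mul1r -mulrBr normrM ger0_norm ?exprn_ge0// mulrCA ler_wpM2l ?exprn_ge0//.
  rewrite [leRHS]mulrC /ln1pexp; apply: ln1p_power_polyP.
  by rewrite expR_ge0 -expR0 ler_expR oppr_le0.
- by rewrite expr1n divr1 ler_wpM2r.
Qed.

Lemma alt_mzvE (R : realType) (k m : nat) :
  alt_mzv R k.+2 m = (-1) ^+ m.+1 / k`!%:R * ln1pexp_moment R k m.+1.
Proof. by apply/cvg_lim => //; exact: cvg_alt_mzv_partial. Qed.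

(** * Expansion of the integrand in powers of 1/n *)

Lemma is_derive_mulr (R : realType) (l h : R) : is_derive h 1 (fun h => h * l) l.
Proof.
have := is_deriveZ l (is_derive_id h (1 : R)).
have -> : l \*: id = (fun h => h * l) by apply/funext => x; rewrite mulrC.
by move=> /is_derive_eq; apply; rewrite /GRing.scale /= mulr1.
Qed.

(** The derivatives of e^(h l) - 1 with respect to h. *)
Definition exp_factor (R : realType) (l : R) (j : nat) (h : R) : R :=
  l ^+ j * expR (h * l) - (j == 0%N)%:R.

Lemma exp_factor_chain (R : realType) (l : R) : derivative_chain R (exp_factor R l).
Proof.
move=> j h.
have := is_deriveB (is_deriveZ (l ^+ j) (@is_derive1_comp R expR (fun h => h * l) h _ _
  (is_derive_expR _) (is_derive_mulr R l h))) (is_derive_cst ((j == 0%N)%:R : R) h (1 : R)).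
move=> /is_derive_eq; apply.
by rewrite /exp_factor /GRing.scale /= exprS; ring.
Qed.

(** The derivatives of g(h s) with respect to h. *)
Definition scaled_weight (R : realType) (s : R) (i : nat) (h : R) : R :=
  s ^+ i * sigmoid_weight R i (h * s).

Lemma scaled_weight_chain (R : realType) (s : R) : derivative_chain R (scaled_weight R s).
Proof.
move=> i h.
have := is_deriveZ (s ^+ i) (@is_derive1_comp R (sigmoid_weight R i) (fun h => h * s) h _ _
  (sigmoid_weight_chain R i _) (is_derive_mulr R s h)).
move=> /is_derive_eq; apply.
by rewrite /scaled_weight /GRing.scale /= exprS; ring.
Qed.

(** The n-th derivative of g(h s) (e^(h l(s)) - 1) with respect to h. *)
Definition residual_integrand (R : realType) (s : R) (n : nat) (h : R) : R :=
  \sum_(i < n.+1) 'C(n, i)%:R *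
    (scaled_weight R s i h * exp_factor R (ln1pexp R s) (n - i)%N h).

Lemma residual_integrand_chain (R : realType) (s : R) :
  derivative_chain R (residual_integrand R s).
Proof.
exact: leibniz_chain R _ _ (scaled_weight_chain R s) (exp_factor_chain R _).
Qed.

(** At every order a factor l(s) <= e^-s is present; at order 0 it comes from
e^u - 1 <= u e^u. *)
Lemma exp_factor_bound (R : realType) (s h : R) (j : nat) : 0 <= s -> 0 <= h <= 1 ->
  `|exp_factor R (ln1pexp R s) j h| <= expR (- s) * expR 1.
Proof.
move=> s0 /andP[h0 h1]; set l := ln1pexp R s.
have l0 : 0 <= l by exact: ln1pexp_ge0.
have hl0 : 0 <= h * l by rewrite mulr_ge0.
have le1 : expR (h * l) <= expR 1.
  by rewrite ler_expR mulr_ile1// ln1pexp_le1.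
rewrite /exp_factor; case: j => [|j] /=.
  rewrite expr0 mul1r ger0_norm ?subr_ge0 -?expR0 ?ler_expR// expR0.
  apply: (@le_trans _ _ (h * l * expR (h * l))).
    have := expR_ge1Dx (- (h * l)); rewrite expRN.
    have e0 := expR_gt0 (h * l).
    rewrite -(ler_pM2r e0) mulVf ?lt0r_neq0//; lra.
  rewrite ler_pM ?expR_ge0//.
  apply: (le_trans _ (ln1pexp_le R s)); exact: ler_piMl.
rewrite subr0 ger0_norm ?mulr_ge0 ?exprn_ge0 ?expR_ge0//.
by rewrite ler_pM ?exprn_ge0 ?expR_ge0// ln1pexp_pow_le.
Qed.

Lemma residual_integrand_bound (R : realType) (n : nat) : exists C : R,
  forall s h, 0 <= s -> 0 <= h <= 1 ->
  `|residual_integrand R s n h| <= C * (s ^+ 0 * expR (- (1 / 2 * s))).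
Proof.
have /choice[W HW] := bounded_sigmoid_weight R.
exists (\sum_(i < n.+1) 'C(n, i)%:R * (i`!%:R * (2 / 1) ^+ i * (W i * expR 1))).
move=> s h s0 h01; rewrite expr0 mul1r mulr_suml.
apply: (le_trans (ler_norm_sum _ _ _)); apply: ler_sum => i _.
rewrite normrM ger0_norm// -[leRHS]mulrA ler_wpM2l//.
rewrite normrM /scaled_weight normrM (ger0_norm (exprn_ge0 i s0)).
have W0 : 0 <= W i by apply: le_trans (HW i 0).
have := ler_exprn_expR_half R i 1 s ltr01 s0; rewrite mul1r => Hs.
apply: (@le_trans _ _ (s ^+ i * W i * (expR (- s) * expR 1))).
  rewrite ler_pM ?mulr_ge0 ?exprn_ge0//; last exact: exp_factor_bound.
  by rewrite ler_wpM2l// exprn_ge0.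
have -> : s ^+ i * W i * (expR (- s) * expR 1) = s ^+ i * expR (- s) * (W i * expR 1) by ring.
by rewrite [leRHS]mulrAC ler_wpM2r// mulr_ge0// expR_ge0.
Qed.

Lemma measurable_residual_integrand (R : realType) (n : nat) (h : R) :
  measurable_fun setT (fun s => residual_integrand R s n h).
Proof.
apply: measurable_sum => i; apply: measurable_funM => //.
apply: measurable_funM.
  apply: measurable_funM; first exact: measurable_funX.
  apply: (@measurableT_comp _ _ _ _ _ _ (sigmoid_weight R i)).
    apply: continuous_measurable_fun.
    exact: (is_derive_continuous R _ _ (sigmoid_weight_chain R i)).
  exact: measurable_funM.
apply: measurable_funB => //; apply: measurable_funM.
  by apply: measurable_funX; exact: measurable_ln1pexp.
apply: (@measurableT_comp _ _ _ _ _ _ (@expR R)) => //.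
by apply: measurable_funM => //; exact: measurable_ln1pexp.
Qed.

Lemma integrable_residual_integrand (R : realType) (n : nat) (h : R) : 0 <= h <= 1 ->
  mu.-integrable `[0%R, +oo[ (EFin \o (fun s => residual_integrand R s n h)).
Proof.
move=> h01; have [C HC] := residual_integrand_bound R n.
apply: (integrable_dominated R _ 0 (1 / 2) C); [lra|exact: measurable_residual_integrand|].
by move=> s s0; exact: HC.
Qed.

Definition residual_coef (R : realType) (k : nat) : R :=
  \sum_(i < k) sigmoid_weight R i 0 / i`!%:R * ln1pexp_moment R i (k - i)%N.

(** The term i = k of Leibniz' rule drops out because e^(h l) - 1 vanishes at
h = 0. *)
Lemma residual_integrand_at0 (R : realType) (s : R) (k : nat) :
  residual_integrand R s k 0 / k`!%:R =
  \sum_(i < k) sigmoid_weight R i 0 / i`!%:R *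
    (s ^+ i * (ln1pexp R s ^+ (k - i)%N / (k - i)`!%:R)).
Proof.
rewrite /residual_integrand big_ord_recr /= subnn /exp_factor expr0 !mul0r expR0 mulr1.
rewrite subrr !mulr0 addr0 mulr_suml; apply: eq_bigr => i _.
have ik : (i <= k)%N by exact: ltnW.
rewrite mulr1 /scaled_weight mul0r.
have -> : (k - i)%N == 0%N = false by rewrite subn_eq0 leqNgt ltn_ord.
rewrite subr0.
have := bin_fact ik => /(congr1 (fun x => x%:R : R)); rewrite !natrM => <-.
by field; rewrite !pnatr_eq0 -!lt0n !fact_gt0 bin_gt0 ik.
Qed.

Lemma Rintegral_residual_integrand_at0 (R : realType) (k : nat) :
  \int[mu]_(s in `[0%R, +oo[) (residual_integrand R s k 0 / k`!%:R) = residual_coef R k.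
Proof.
under eq_Rintegral do rewrite residual_integrand_at0.
have mi (i : 'I_k) : mu.-integrable `[0%R, +oo[ (EFin \o (fun s : R =>
    s ^+ i * (ln1pexp R s ^+ (k - i)%N / (k - i)`!%:R))).
  by rewrite -(subnSK (ltn_ord i)); exact: integrable_exprn_ln1pexp.
rewrite Rintegral_sum.
  by apply: eq_bigr => i _; rewrite RintegralZl//; exact: mi.
by move=> i; apply: (@integrableZl _ _ _ mu _ _ (sigmoid_weight R i 0 / i`!%:R)
  (EFin \o (fun s : R => s ^+ i * (ln1pexp R s ^+ (k - i)%N / (k - i)`!%:R)))).
Qed.

(** The Taylor bound of the integrand is uniform in s up to a factor e^(-s/2),
which is integrable. *)
Lemma residual_integral_expansion (R : realType) (n : nat) :
  exists C : R, forall h, 0 <= h <= 1 ->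
  `|\int[mu]_(s in `[0%R, +oo[) residual_integrand R s 0 h -
    \sum_(k < n) residual_coef R k * h ^+ k| <= C * h ^+ n.
Proof.
have [C HC] := residual_integrand_bound R n.
exists (C * (0`!%:R / (1 / 2) ^+ 1)) => h /andP[h0 h1].
have fi (k : 'I_n) : mu.-integrable `[0%R, +oo[ (EFin \o
    (fun s : R => h ^+ k / k`!%:R * residual_integrand R s k 0)).
  apply: (@integrableZl _ _ _ mu _ _ (h ^+ k / k`!%:R)
    (EFin \o (fun s : R => residual_integrand R s k 0))) => //.
  by apply: integrable_residual_integrand; rewrite lexx ler01.
have E : \sum_(k < n) residual_coef R k * h ^+ k =
    \int[mu]_(s in `[0%R, +oo[) (\sum_(k < n) h ^+ k / k`!%:R * residual_integrand R s k 0).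
  rewrite Rintegral_sum//; apply: eq_bigr => k _.
  rewrite -Rintegral_residual_integrand_at0 RintegralZl//; last first.
    by apply: integrable_residual_integrand; rewrite lexx ler01.
  under eq_Rintegral do rewrite mulrC.
  rewrite RintegralZl//; first by field; rewrite pnatr_eq0 -lt0n fact_gt0.
  by apply: integrable_residual_integrand; rewrite lexx ler01.
have i0 : mu.-integrable `[0%R, +oo[ (EFin \o (fun s => residual_integrand R s 0 h)).
  by apply: integrable_residual_integrand; rewrite h0.
have isum : mu.-integrable `[0%R, +oo[ (EFin \o (fun s =>
    \sum_(k < n) h ^+ k / k`!%:R * residual_integrand R s k 0)).
  have -> : EFin \o (fun s => \sum_(k < n) h ^+ k / k`!%:R * residual_integrand R s k 0) =
      (fun s => \sum_(k < n) (h ^+ k / k`!%:R * residual_integrand R s k 0)%:E)%E.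
    by apply/funext => s; rewrite sumEFin.
  by apply: integrable_sum => // k _; exact: fi.
rewrite E -RintegralB// mulrAC.
apply: Rintegral_dominated; first lra.
  apply: measurable_funB; first exact: measurable_residual_integrand.
  by apply: measurable_sum => k; apply: measurable_funM => //;
    exact: measurable_residual_integrand.
move=> s s0; rewrite mulrAC.
have -> : \sum_(k < n) h ^+ k / k`!%:R * residual_integrand R s k 0 =
    \sum_(k < n) residual_integrand R s k 0 / k`!%:R * h ^+ k.
  by apply: eq_bigr => k _; ring.
apply: (taylor_chain R n (residual_integrand R s)) => //;
  first exact: residual_integrand_chain.
by move=> t /andP[t0 th]; apply: HC => //; rewrite t0 (le_trans th).
Qed.

(** * Change of variables to the half-line *)

Lemma cvg_sigmoid_pinfty (R : realType) (h : R) : 0 < h ->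
  sigmoid R (h * s) @[s --> +oo] --> (1 : R).
Proof.
move=> h0; rewrite /sigmoid -[X in _ --> X]invr1; apply: cvgV => //.
rewrite -[X in _ --> X]addr0; apply: cvgD; first exact: cvg_cst.
exact: cvg_expRNM.
Qed.

Lemma continuous_ln1pexp (R : realType) : continuous (ln1pexp R).
Proof.
move=> s; apply: (@continuous_comp _ _ _ (fun s : R => 1 + expR (- s)) (@ln R)).
  have := is_deriveD (is_derive_cst (1 : R) s (1 : R)) (is_derive_expRNM R 1 s).
  rewrite (_ : (cst 1 + (fun s0 : R => expR (- (1 * s0)))) = (fun s : R => 1 + expR (- s))).
    move=> ds; apply: differentiable_continuous; apply/derivable1_diffP.
    exact: (@ex_derive _ _ _ _ _ _ _ ds).
  by apply/funext => t; rewrite !fctE mul1r.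
by apply: continuous_ln; exact: sigmoid_den_gt0.
Qed.

Definition I_integrand (R : realType) (n x : R) : R :=
  (x `^ n + (1 - x) `^ n) `^ n^-1.

Lemma I_integrand_bound (R : realType) (n x : R) : 1 <= n -> 0 <= x <= 1 ->
  `|I_integrand R n x| <= 2.
Proof.
move=> n1 /andP[x0 x1]; have n0 : 0 <= n by lra.
have p1 (y : R) : 0 <= y -> y <= 1 -> y `^ n <= 1.
  have e1 : (1 : R) `^ n = 1 by rewrite powR1.
  move=> y0 y1; rewrite -[leRHS]e1.
  by apply: ge0_ler_powR => //; rewrite nnegrE.
rewrite /I_integrand ger0_norm ?powR_ge0//.
have a2 : x `^ n + (1 - x) `^ n <= 2.
  have := p1 x x0 x1; have := p1 (1 - x); lra.
apply: (@le_trans _ _ (2 `^ n^-1)).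
  by apply: ge0_ler_powR; rewrite ?nnegrE ?invr_ge0 ?addr_ge0 ?powR_ge0.
rewrite -[leRHS]powRr1//; apply: ler_powR; first lra.
by rewrite invf_le1//; lra.
Qed.

Lemma integrable_I_integrand (R : realType) (n : R) : 1 <= n ->
  mu.-integrable `[0%R, 1%R] (EFin \o I_integrand R n).
Proof.
move=> n1; apply: measurable_bounded_integrable => //.
- by rewrite /= lebesgue_measure_itv /= lte01 -EFinB ltry.
- apply: measurable_funTS; apply: (@measurableT_comp _ _ _ _ _ _ (fun x => x `^ n^-1)).
    exact: measurable_powR.
  apply: measurable_funD; first exact: measurable_powR.
  apply: (@measurableT_comp _ _ _ _ _ _ (fun x => x `^ n)).
    exact: measurable_powR.
  exact: measurable_funB.
- exists 2; split; first exact: num_real.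
  move=> M M2 x; rewrite /= in_itv /= => x01.
  by apply: (le_trans (I_integrand_bound R n x n1 x01)); exact: ltW.
Qed.

Lemma continuous_powR_comp (R : realType) (f : R -> R) (a x : R) :
  0 < f x -> {for x, continuous f} -> {for x, continuous (fun y => f y `^ a)}.
Proof.
move=> fx cf; apply: (@continuous_comp _ _ _ f (fun y => y `^ a)) => //.
apply: differentiable_continuous; apply/derivable1_diffP.
by apply: derivable_powR; rewrite in_itv /= andbT.
Qed.

Lemma continuous_I_integrand (R : realType) (n x : R) : 0 < x < 1 ->
  {for x, continuous (I_integrand R n)}.
Proof.
move=> /andP[x0 x1]; have x1' : 0 < 1 - x by lra.
apply: continuous_powR_comp.
  by rewrite addr_gt0// powR_gt0.
apply: (@continuousD _ _ _ (fun y => y `^ n) (fun y => (1 - y) `^ n)).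
  exact: (continuous_powR_comp R id).
apply: (continuous_powR_comp R (fun y => 1 - y)) => //.
by apply: continuousB => //; exact: cvg_cst.
Qed.

(** If x = sigma(v) with v = s/n, then 1 - x = x e^-v and (e^-v)^n = e^-s. *)
Lemma I_integrand_sigmoid (R : realType) (n s : R) : 0 < n ->
  I_integrand R n (sigmoid R (n^-1 * s)) =
  sigmoid R (n^-1 * s) * expR (n^-1 * ln1pexp R s).
Proof.
move=> n0; set v := n^-1 * s; have n0' := lt0r_neq0 n0.
have s0 := sigmoid_gt0 R v; have den0 := sigmoid_den_gt0 R v.
have E : 1 - sigmoid R v = sigmoid R v * expR (- v).
  by rewrite /sigmoid; field; rewrite lt0r_neq0.
rewrite /I_integrand E powRM ?expR_ge0 ?(ltW s0)//.
have -> : expR (- v) `^ n = expR (- s).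
  rewrite /powR (negbTE (lt0r_neq0 (expR_gt0 _))) expRK; congr expR.
  by rewrite /v; field.
rewrite -[X in X + _]mulr1 -mulrDr powRM ?powR_ge0 ?addr_ge0 ?expR_ge0//.
rewrite -powRrM divff// powRr1 ?(ltW s0)//; congr (_ * _).
by rewrite /powR (negbTE (lt0r_neq0 (sigmoid_den_gt0 R s))).
Qed.

Lemma I_integrand_sym (R : realType) (n x : R) :
  I_integrand R n (1 - x) = I_integrand R n x.
Proof. by rewrite /I_integrand subKr addrC. Qed.

Definition halfline_integrand (R : realType) (h s : R) : R :=
  2 * h * (sigmoid_weight R 0 (h * s) * expR (h * ln1pexp R s)).

Lemma continuous_sigmoid_weight_scaled (R : realType) (h : R) :
  continuous (fun s => sigmoid_weight R 0 (h * s)).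
Proof.
move=> s; apply: (@continuous_comp _ _ _ (fun s => h * s) (sigmoid_weight R 0)).
  by apply: cvgM; [exact: cvg_cst|exact: cvg_id].
exact: (is_derive_continuous R _ _ (sigmoid_weight_chain R 0)).
Qed.

Lemma continuous_halfline_integrand (R : realType) (h : R) :
  continuous (halfline_integrand R h).
Proof.
move=> s; apply: cvgM; first exact: cvg_cst.
apply: cvgM; first exact: continuous_sigmoid_weight_scaled.
apply: (@continuous_comp _ _ _ (fun s => h * ln1pexp R s) (@expR R)).
  by apply: cvgM; [exact: cvg_cst|exact: continuous_ln1pexp].
exact: continuous_expR.
Qed.

(** Let A be the integral of the integrand from 0 and h = 1/n. The function
A(sigma(h s)) - A(1 - sigma(h s)) goes from 0 at s = 0 to A(1) = I(n) at
infinity, and its derivative is the integrand on the right: the fundamental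
theorem of calculus performs the substitution and the symmetry at once. *)
Lemma I_int_halfline (R : realType) (n : R) : 1 <= n ->
  I_int n = \int[mu]_(s in `[0%R, +oo[) halfline_integrand R n^-1 s.
Proof.
move=> n1; have n0 : 0 < n by lra.
have h0 : 0 < n^-1 by rewrite invr_gt0.
pose A (x : R) := \int[mu]_(t in `[0%R, x]) I_integrand R n t.
have A0 : A 0 = 0 by rewrite /A set_itv1 Rintegral_set1.
have Ai := integrable_I_integrand R n n1.
have dA (x : R) : 0 < x < 1 -> is_derive x 1 A (I_integrand R n x).
  move=> /andP[x0 x1].
  have [] := @continuous_FTC1 R (I_integrand R n) (BLeft 0) x 1 x1 Ai.
  - by [].
  - by apply: continuous_I_integrand; rewrite x0.
  by move=> dA dAE; split => //; rewrite -derive1E.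
have [_ cA0 cA1] : [/\ {in `]0, 1[, continuous A}, A x @[x --> 0^'+] --> A 0 &
    A x @[x --> 1^'-] --> A 1].
  by apply/continuous_within_itvP; last exact: parameterized_integral_continuous.
pose sg (s : R) := sigmoid R (n^-1 * s).
have dsg (s : R) : is_derive s 1 sg ((sg s - sg s ^+ 2) * n^-1).
  have := @is_derive1_comp R (sigmoid R) (fun s => n^-1 * s) s _ _ (is_derive_sigmoid R _)
    (is_deriveZ n^-1 (is_derive_id s (1 : R))).
  by move=> /is_derive_eq; apply; rewrite /GRing.scale /= mulr1.
have sg01 s : 0 < sg s < 1 by rewrite sigmoid_gt0 sigmoid_lt1.
have csg : sg s @[s --> +oo] --> (1 : R) by exact: cvg_sigmoid_pinfty.
pose Phi s := A (sg s) - A (1 - sg s).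
have dPhi (s : R) (_ : 0 <= s) : is_derive s 1 Phi (halfline_integrand R n^-1 s).
  have d1 := @is_derive1_comp R A sg s _ _ (dA _ (sg01 s)) (dsg s).
  have s01 : 0 < 1 - sg s < 1 by have := sg01 s; lra.
  have d2 := @is_derive1_comp R A (fun s => 1 - sg s) s _ _ (dA _ s01)
    (is_deriveB (is_derive_cst (1 : R) s (1 : R)) (dsg s)).
  have := is_deriveB d1 d2; move=> /is_derive_eq; apply.
  rewrite I_integrand_sym /sg I_integrand_sigmoid// /halfline_integrand sigmoid_weight0E.
  by ring.
have Phi0 : Phi 0 = 0.
  rewrite /Phi /sg mulr0 /sigmoid oppr0 expR0.
  have -> : 1 - (1 + 1)^-1 = (1 + 1)^-1 :> R by field.
  by rewrite subrr.
have Phioo : Phi s @[s --> +oo] --> A 1 - A 0.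
  apply: cvgB.
    (* A is continuous at the ends of the interval from inside only, so the
    limits of sigma(h s) have to be taken one-sidedly. *)
    apply: (@cvg_comp _ _ _ sg A _ (1^'-)) cA1.
    move=> P HP; have H : \forall s \near +oo, sg s < 1 -> P (sg s) := csg _ HP.
    change (\forall s \near +oo, P (sg s)); apply: filterS H => s; apply.
    by have /andP[] := sg01 s.
  apply: (@cvg_comp _ _ _ (fun s => 1 - sg s) A _ (0^'+)) cA0.
  have c0 : 1 - sg s @[s --> +oo] --> (0 : R).
    by rewrite -(subrr 1); apply: cvgB => //; exact: cvg_cst.
  move=> P HP; have H : \forall s \near +oo, 0 < 1 - sg s -> P (1 - sg s) := c0 _ HP.
  change (\forall s \near +oo, P (1 - sg s)); apply: filterS H => s; apply.
  by have /andP[] := sg01 s; lra.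
have pos (s : R) : 0 <= s -> 0 <= halfline_integrand R n^-1 s.
  move=> _; apply: mulr_ge0; first by apply: mulr_ge0 => //; exact: ltW.
  by apply: mulr_ge0; [exact: sigmoid_weight0_ge0|exact: expR_ge0].
have := integral_halfline_primitive R _ _ _ (continuous_halfline_integrand R n^-1) pos dPhi Phioo.
by rewrite /Rintegral => ->; rewrite Phi0 A0 !subr0 -EFinB subr0.
Qed.

(** 2 sigma sigma' is the derivative of sigma^2, which goes from 1/4 to 1. *)
Lemma Rintegral_sigmoid_weight (R : realType) (h : R) : 0 < h ->
  mu.-integrable `[0%R, +oo[ (EFin \o (fun s => 2 * h * sigmoid_weight R 0 (h * s))) /\
  \int[mu]_(s in `[0%R, +oo[) (2 * h * sigmoid_weight R 0 (h * s)) = 3 / 4.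
Proof.
move=> h0.
have cf : continuous (fun s => 2 * h * sigmoid_weight R 0 (h * s)).
  by move=> s; apply: cvgM; [exact: cvg_cst|exact: continuous_sigmoid_weight_scaled].
have pos (s : R) : 0 <= s -> 0 <= 2 * h * sigmoid_weight R 0 (h * s).
  move=> _; apply: mulr_ge0; last exact: sigmoid_weight0_ge0.
  by apply: mulr_ge0 => //; exact: ltW.
pose F s := sigmoid R (h * s) ^+ 2.
have dF (s : R) (_ : 0 <= s) : is_derive s 1 F (2 * h * sigmoid_weight R 0 (h * s)).
  have dsg := @is_derive1_comp R (sigmoid R) (fun s => h * s) s _ _ (is_derive_sigmoid R _)
    (is_deriveZ h (is_derive_id s (1 : R))).
  have := is_deriveX 2 dsg.
  have -> : (sigmoid R \o [eta *%R h]) ^+ 2 = F by apply/funext => t; rewrite /F fctE.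
  move=> /is_derive_eq; apply; rewrite /GRing.scale /= sigmoid_weight0E; ring.
have Foo : F s @[s --> +oo] --> (1 : R).
  rewrite -(expr1n _ 2); apply: (@cvg_comp _ _ _ _ (fun x => x ^+ 2)).
    exact: cvg_sigmoid_pinfty.
  exact: exprn_continuous.
have H := integral_halfline_primitive R _ _ _ cf pos dF Foo.
have F0 : F 0 = 1 / 4 by rewrite /F mulr0 /sigmoid oppr0 expR0; field.
split; last by rewrite /Rintegral H F0 -EFinB /=; field.
apply/integrableP; split.
  by apply/measurable_EFinP; apply: measurable_funTS; exact: continuous_measurable_fun.
under eq_integral => s.
  rewrite inE /= in_itv /= andbT => s0.
  rewrite ger0_norm ?pos//.
  over.
by rewrite H -EFinB ltry.
Qed.

Lemma I_intE (R : realType) (n : R) : 1 <= n ->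
  I_int n = 3 / 4 + 2 * n^-1 * \int[mu]_(s in `[0%R, +oo[) residual_integrand R s 0 n^-1.
Proof.
move=> n1; have n0 : 0 < n by lra.
have h0 : 0 < n^-1 by rewrite invr_gt0.
have h01 : 0 <= n^-1 <= 1 by rewrite ltW//= invf_le1.
have [wi wE] := Rintegral_sigmoid_weight R n^-1 h0.
have ii := integrable_residual_integrand R 0 n^-1 h01.
rewrite I_int_halfline// -wE -RintegralZl// -RintegralD//.
  apply: eq_Rintegral => s _.
  rewrite /halfline_integrand /residual_integrand big_ord_recl big_ord0 addr0 bin0 mul1r.
  by rewrite /scaled_weight /exp_factor !expr0; rewrite /=; ring.
by apply: (@integrableZl _ _ _ mu _ _ (2 * n^-1)
  (EFin \o (fun s : R => residual_integrand R s 0 n^-1))).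
Qed.

(** * The asymptotic series *)

(** Once the coefficients below p agree, subtracting the two expansions to
order p leaves |c p - d p| <= (C + D) / n. *)
Lemma asymptotic_series_unique (R : realType) (f : R -> R) (c d : nat -> R) :
  asymptotic_series f c -> asymptotic_series f d -> c =1 d.
Proof.
move=> fc fd p; elim/ltn_ind: p => p IHp.
have [C HC] := fc p; have [D HD] := fd p.
apply/eqP; rewrite -subr_eq0 -normr_le0; apply/ler_addgt0Pr => e e0.
rewrite add0r.
near (pinfty_nbhs R) => n.
have n0 : 0 < n by near: n; apply: nbhs_pinfty_gt; exact: num_real.
(* Beyond this n the bound (C + D) / n is at most e. *)
have nC : (`|C| + `|D|) / e <= n by near: n; apply: nbhs_pinfty_ge; exact: num_real.
have hC : `|f n - \sum_(j < p.+1) c j * n ^- j| <= C * n ^- p.+1 by near: n.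
have hD : `|f n - \sum_(j < p.+1) d j * n ^- j| <= D * n ^- p.+1 by near: n.
have np : 0 < n ^- p by rewrite invr_gt0 exprn_gt0.
have E : (c p - d p) * n ^- p = (f n - \sum_(j < p.+1) d j * n ^- j) -
    (f n - \sum_(j < p.+1) c j * n ^- j).
  rewrite !big_ord_recr /=.
  have -> : \sum_(j < p) c j * n ^- j = \sum_(j < p) d j * n ^- j.
    by apply: eq_bigr => j _; rewrite IHp.
  ring.
have : `|c p - d p| * n ^- p <= (C + D) * n ^- p.+1.
  rewrite -{1}(gtr0_norm np) -normrM E mulrDl [leRHS]addrC.
  by apply: (le_trans (ler_normB _ _)); rewrite lerD.
have -> : n ^- p.+1 = n^-1 * n ^- p by rewrite exprS invfM.
rewrite mulrA ler_pM2r// => /le_trans; apply.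
rewrite ler_pdivrMr//; move: nC; rewrite ler_pdivrMr// => /(le_trans _); rewrite mulrC; apply.
by rewrite lerD ?ler_norm.
Unshelve. all: by end_near. Qed.

Definition I_coef (R : realType) (p : nat) : R :=
  if p is k.+1 then 2 * residual_coef R k else 3 / 4.

Lemma I_int_asymptotic (R : realType) : asymptotic_series (@I_int R) (I_coef R).
Proof.
move=> N; have [C HC] := residual_integral_expansion R N.
exists (2 * C); near=> n.
have n1 : 1 <= n by near: n; apply: nbhs_pinfty_ge; exact: num_real.
have n0 : 0 < n by lra.
have h0 : 0 <= n^-1 by rewrite invr_ge0 ltW.
have h01 : 0 <= n^-1 <= 1 by rewrite h0 invf_le1.
rewrite I_intE// big_ord_recl /= invr1 mulr1 opprD addrACA subrr add0r.
have -> : \sum_(i < N) I_coef R (bump 0 i) * n ^- bump 0 i =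
    2 * n^-1 * \sum_(k < N) residual_coef R k * n^-1 ^+ k.
  rewrite mulr_sumr; apply: eq_bigr => i _; rewrite /bump /= add1n -exprVn exprS.
  ring.
rewrite -mulrBr normrM ger0_norm ?mulr_ge0// -exprVn exprS.
have -> : 2 * C * (n^-1 * n^-1 ^+ N) = 2 * n^-1 * (C * n^-1 ^+ N) by ring.
by rewrite ler_wpM2l ?mulr_ge0// HC.
Unshelve. all: by end_near. Qed.

(** The sum is reindexed by j = i + 2. The sign (-1)^(i+1) of the derivative of g
and the sign (-1)^(p-i-1) of the moment multiply to (-1)^p. *)
Lemma I_coefE (R : realType) (p : nat) : (2 <= p)%N ->
  I_coef R p = (-1) ^+ p *
    \sum_(2 <= j < p.+1) a_coef R (j.-1)./2 * alt_mzv R j (p - j).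
Proof.
case: p => [//|[//|q]] _.
rewrite /I_coef /residual_coef (big_addn 0 q.+3 2 predT) subSS subSS subn0 big_mkord.
rewrite !mulr_sumr; apply: eq_bigr => i _.
rewrite addn2 /= alt_mzvE sigmoid_weight_at0 !subSS.
have iq : (i <= q)%N by rewrite -ltnS.
rewrite subSn//.
have -> : (-1) ^+ q.+2 = (-1) ^+ i.+1 * (-1) ^+ (q - i).+1 :> R.
  by rewrite -exprD addnS addSn subnKC.
set u := (-1) ^+ (q - i).+1; set w := (-1) ^+ i.+1.
have u2 : u * u = 1 by rewrite -exprMn mulrNN mulr1 expr1n.
have f0 : i`!%:R != 0 :> R by rewrite pnatr_eq0 -lt0n fact_gt0.
transitivity (u * u * (w * a_coef R (uphalf i) / i`!%:R * ln1pexp_moment R i (q - i).+1)).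
  by rewrite u2; field.
by field.
Qed.

Theorem theorem1 (R : realType) :
  [/\ exists c : nat -> R, asymptotic_series (@I_int R) c,
      forall c : nat -> R, asymptotic_series (@I_int R) c ->
        forall p : nat, (2 <= p)%N ->
          c p = (-1) ^+ p *
            \sum_(2 <= j < p.+1) a_coef R (j.-1)./2 * alt_mzv R j (p - j)
    & forall n : nat,
        a_coef R n = (1 - 2 ^+ (2 * n + 2)) * bernoulli_number R (2 * n + 2)
                       / (2 * n + 2)%:R].
Proof.
split; first by exists (I_coef R); exact: I_int_asymptotic.
- move=> c Ic p p2.
  rewrite (asymptotic_series_unique R _ _ _ Ic (I_int_asymptotic R)).
  exact: I_coefE.
- exact: a_coef_bernoulli.
Qed.
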